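(* Let $n,d,k\ge 1$ be integers and let $\mathcal{T}\in\mathcal{R}_{n,d,k}$ be a $k$-tuple of degree $d$ hypersurfaces in $\mathbb{P}^n$. If $\mathrm{lct}(\mathbb{P}^n,F)\ge\frac{n+1}{d}$ for every hypersurface $F=\{f=0\}$ in $\mathcal{T}$, then $\mathcal{T}$ is semistable. If $\mathrm{lct}(\mathbb{P}^n,F)>\frac{n+1}{d}$ for every hypersurface $F=\{f=0\}$ in $\mathcal{T}$, then $\mathcal{T}$ is stable.
   Context: The base field is $\mathbb{C}$. Let $W=H^0(\mathbb{P}^n,\mathcal{O}_{\mathbb{P}^n}(d))$ and $\mathcal{R}_{n,d,k}=\operatorname{Gr}(k,W)$, the Grassmannian of $k$-dimensional linear subspaces of $W$, embedded in $\mathbb{P}\bigwedge^k W$ by the Plücker embedding. A point $\mathcal{T}\in\mathcal{R}_{n,d,k}$ spanned by linearly independent forms $f_1,\dots,f_k$ is regarded as the linear system $\mathcal{T}=\{\sum_{i=1}^k z_if_i \mid (z_1:\dots:z_k)\in\mathbb{P}^{k-1}\}$, called a $k$-tuple; the hypersurfaces $F=\{f=0\}$ with $f$ a nonzero element of the span are its members, written $F\in\mathcal{T}$. The group $G=\operatorname{SL}(n+1)$ acts on $W$ by $(A\cdot f)(x)=f(Ax)$, hence on $\mathcal{R}_{n,d,k}\subset\mathbb{P}\bigwedge^kW$; (semi)stability of $\mathcal{T}$ is GIT (semi)stability for this action, linearised by the Plücker line bundle (stable means properly stable, i.e. the Hilbert–Mumford weight is strictly positive for every non-trivial one-parameter subgroup).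 For a hypersurface $F\subset\mathbb{P}^n$, $\mathrm{lct}(\mathbb{P}^n,F)=\sup\{t\in\mathbb{Q}\mid(\mathbb{P}^n,tF)\text{ is log canonical}\}$. *)

(* Defs.v *)
From HB Require Import structures.
From mathcomp Require Import all_boot all_order all_algebra.
From mathcomp Require Import fraction generic_quotient.
From mathcomp Require Import classical_sets reals.
From mathcomp Require Import complex.
From mathcomp Require Import mpoly.

Set Implicit Arguments.
Unset Strict Implicit.
Unset Printing Implicit Defensive.

Import Order.TTheory GRing.Theory Num.Theory.

Local Open Scope ring_scope.
Local Open Scope complex_scope.
Local Open Scope quotient_scope.

(* The base field is R[i] for R : realType, i.e. the complex numbers. *)

Section Discrepancy.
Variables (R : realType) (n : nat).

(* The function field of A^n, with standard coordinates z_0, ..., z_{n-1}. *)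
Definition funfield := {fraction {mpoly R[i][n]}}.

Definition ratfun (p : {mpoly R[i][n]}) : funfield := FracField.tofrac p.

(* Quotient rule; the value does not depend on the chosen representative. *)
Definition fderiv (j : 'I_n) (x : funfield) : funfield :=
  let p := \n_(repr x) in let q := \d_(repr x) in
  ratfun (p^`M(j) * q - p * q^`M(j)) / ratfun q ^+ 2.

(* The determinant of (dy_i / dz_j). *)
Definition jacobian (y : 'I_n -> funfield) : funfield :=
  \det (\matrix_(i < n, j < n) fderiv j (y i)).

(* Values of v at 0 carry no information. *)
Definition valuation (v : funfield -> int) : Prop :=
  [/\ forall c : R[i], c != 0 -> v (ratfun c%:MP) = 0,
      forall x y, x != 0 -> y != 0 -> v (x * y) = v x + v y
    & forall x y, x != 0 -> y != 0 -> x + y != 0 ->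
        Num.min (v x) (v y) <= v (x + y)].

Definition centered_on_affine_space (v : funfield -> int) : Prop :=
  forall p : {mpoly R[i][n]}, p != 0 -> 0 <= v (ratfun p).

(* y_{i0} is a uniformizer of the valuation ring of v, and the residues of the
   n - 1 other y_i are algebraically independent over the complex numbers:
   g(y) is a unit of the valuation ring for every nonzero polynomial g; for
   g a variable this says that the other y_i are themselves units. *)
Definition adapted (v : funfield -> int) (y : 'I_n -> funfield) : Prop :=
  exists i0 : 'I_n,
  [/\ y i0 != 0, v (y i0) = 1
    & forall g : {mpoly R[i][n.-1]}, g != 0 ->
        let gy := mmap (fun c : R[i] => ratfun c%:MP)
                       (fun j => y (lift i0 j)) g in
        gy != 0 /\ v gy = 0].

(* Prime divisors E over A^n (on a normal variety Y with a birational morphism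
   Y -> A^n) correspond, through E |-> ord_E, to the normalized discrete
   valuations of the function field that are trivial on constants, nonnegative
   on polynomials, and whose residue field has transcendence degree n - 1
   (Kollar-Mori, Lemma 2.45).  The residue field has transcendence degree at
   most n - 1 and a value 1 is attained exactly when an adapted y exists.
   For such a y, dy_0, ..., dy_{n-1} is a basis of the module of differentials
   of the local ring O_{Y,E}, so the coefficient of E in K_{Y/A^n}, which is
   the order along E of det (dz_i / dy_j), is - v (jacobian y).  Hence
     a(E, A^n, t {g = 0}) = - v (jacobian y) - t * v(g).  *)
Definition divisor_over (v : funfield -> int) (y : 'I_n -> funfield) : Prop :=
  [/\ valuation v, centered_on_affine_space v & adapted v y].

Definition discrepancy (v : funfield -> int) (y : 'I_n -> funfield)
    (t : rat) (g : {mpoly R[i][n]}) : rat :=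
  - (v (jacobian y))%:~R - t * (v (ratfun g))%:~R.

(* All divisors over A^n are considered, not only the exceptional ones; this
   bounds the coefficients of the pair by 1 also when n = 1. *)
Definition affine_log_canonical (t : rat) (g : {mpoly R[i][n]}) : Prop :=
  forall v y, divisor_over v y -> -1 <= discrepancy v y t g.

End Discrepancy.

Section Lct.
Variables (R : realType) (n : nat).

(* Restriction to the chart x_i = 1, the coordinate x_(lift i j) becoming z_j. *)
Definition dehomogenize (i : 'I_n.+1) (f : {mpoly R[i][n.+1]}) :
    {mpoly R[i][n]} :=
  f \mPo [tuple if unlift i j is Some j' then 'X_j' else 1 | j < n.+1].

(* Every divisor over P^n has its center meeting one of the standard charts,
   and its discrepancy can be computed there. *)
Definition log_canonical (t : rat) (f : {mpoly R[i][n.+1]}) : Prop :=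
  forall i : 'I_n.+1, affine_log_canonical t (dehomogenize i f).

(* For f <> 0 of positive degree the set contains 0 and is bounded by 1, so
   that this is a genuine supremum. *)
Definition lct (f : {mpoly R[i][n.+1]}) : R :=
  sup [set x : R | exists t : rat, log_canonical t f /\ x = ratr t]%classic.

End Lct.

Section Stability.
Variables (R : realType) (n d : nat).

Local Notation W := (dhomog n.+1 R[i] d).

(* (A . f)(x) = f (A x) *)
Definition act (A : 'M[R[i]]_n.+1) (f : {mpoly R[i][n.+1]}) :
    {mpoly R[i][n.+1]} :=
  f \mPo [tuple \sum_(j < n.+1) A i j *: 'X_j | i < n.+1].

Definition monomial := {m : 'X_{1..n.+1 < d.+1} | mdeg m == d}.

(* Arbitrary, rather than increasing, sequences of k monomials.  The additional
   coordinates vanish or agree up to sign with the usual Pluecker coordinates,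
   so homogeneous polynomials in them give the same functions. *)
Definition pluecker_index (k : nat) := {ffun 'I_k -> monomial}.

Definition pluecker (k : nat) (X : 'I_k -> {mpoly R[i][n.+1]})
    (s : pluecker_index k) : R[i] :=
  \det (\matrix_(i < k, j < k) (X i)@_(val (val (s j)))).

Definition pluecker_eval (k : nat) (P : {mpoly R[i][#|pluecker_index k|]})
    (X : 'I_k -> {mpoly R[i][n.+1]}) : R[i] :=
  P.@[fun a => pluecker X (enum_val a)].

(* A section of the m-th power of the Pluecker line bundle on Gr(k, W), k = r,
   is the restriction to the cone of decomposable vectors of a homogeneous
   polynomial of degree m in the Pluecker coordinates. *)
Definition invariant_section (r m : nat)
    (P : {mpoly R[i][#|pluecker_index r|]}) : Prop :=
  P \is m.-homog /\
  forall (X : r.-tuple W) (A : 'M[R[i]]_n.+1), free X -> \det A = 1 ->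
    pluecker_eval P (fun i => act A (tnth X i)) =
    pluecker_eval P (fun i => tnth X i : {mpoly R[i][n.+1]}).

Definition semistable (T : {vspace W}) : Prop :=
  exists (m : nat) (P : {mpoly R[i][#|pluecker_index (\dim T)|]}),
    [/\ (0 < m)%N, invariant_section m P
      & pluecker_eval P (fun i => tnth (vbasis T) i : {mpoly R[i][n.+1]}) != 0].

(* Morphisms of algebraic groups from G_m to SL(n+1); l 0 is irrelevant. *)
Definition one_parameter_subgroup (l : R[i] -> 'M[R[i]]_n.+1) : Prop :=
  [/\ exists (N : nat) (M : 'M[{poly R[i]}]_n.+1),
        forall t, t != 0 -> l t = t ^- N *: map_mx (horner_eval t) M,
      forall t, t != 0 -> \det (l t) = 1
    & forall s t, s != 0 -> t != 0 -> l (s * t) = l s *m l t].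

Definition nontrivial_1ps (l : R[i] -> 'M[R[i]]_n.+1) : Prop :=
  exists2 t, t != 0 & l t != 1%:M.

(* t^mu (l(t) . p) extends to t = 0 with a nonzero value there, p being the
   Pluecker vector of T; equivalently - mu is the least weight of l occurring
   in p. *)
Definition hilbert_mumford_weight (T : {vspace W})
    (l : R[i] -> 'M[R[i]]_n.+1) (mu : int) : Prop :=
  exists q : pluecker_index (\dim T) -> {poly R[i]},
    (forall t s, t != 0 ->
       t ^ mu * pluecker (fun i => act (l t) (tnth (vbasis T) i)) s
       = (q s).[t])
    /\ exists s, (q s).[0] != 0.

Definition stable (T : {vspace W}) : Prop :=
  forall l, one_parameter_subgroup l -> nontrivial_1ps l ->
    exists2 mu : int, hilbert_mumford_weight T l mu & 0 < mu.

End Stability.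

(* Main.v *)
Require Import Defs.
From mathcomp Require Import all_boot all_order all_algebra.
From mathcomp Require Import fraction generic_quotient perm.
From mathcomp Require Import boolp classical_sets reals.
From mathcomp Require Import complex.
From mathcomp Require Import mpoly.
From mathcomp Require Import ring lra zify.

(** Both parts use the contrapositive.  A one-parameter subgroup with weights
    [a_j], [\sum a_j = 0], in coordinates [h^-1 x] gives a monomial valuation
    on the affine chart in which one of the coordinates of minimal weight
    [- mu] is omitted; its log discrepancy is [(n+1) mu] and its value on
    [f] is at least [kappa + d mu] when all monomials of [f (h x)] have weight
    at least [kappa], whence [lct f <= (n+1) mu / (kappa + d mu)].  So, if the
    log canonical thresholds are large, every member of the system has a
    monomial of small weight in every system of coordinates, and a nonzero
    minor on such monomials is a Pluecker coordinate of small weight.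

    Stability is then immediate.  Semistability requires the Hilbert-Mumford
    theorem for [SL (n+1)], applied to the Pluecker vector [p] inside a tensor
    power of the standard representation.  Let [B] be the generic matrix and
    [f_s = (p B)_s ^ N / det B ^ r], of degree 0 in [B].  If a polynomial [Q] with
    [Q 0 <> 0] vanishes at the [f_s], pairing its homogenization with a power
    of [det B] for the apolar form (a Reynolds operator) produces an invariant
    that does not vanish at [p].  Otherwise [f_s |-> 0] defines a place of
    [C (B)]; it extends to a valuation ring with residue field [C] (Zorn), over
    which [B] has a Smith form [L diag (delta) U].  The reduction of [L] and an
    integral weight vector obtained from the valuations of [delta] by
    Fourier-Motzkin elimination destabilize [p]. *)

Set Implicit Arguments.
Unset Strict Implicit.
Unset Printing Implicit Defensive.

Import Order.TTheory GRing.Theory Num.Theory.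

Local Open Scope ring_scope.
Local Open Scope complex_scope.
Local Open Scope quotient_scope.

(** * Linear substitutions and the apolar pairing *)

Section ChainRule.
Variables (A : comNzRingType) (n k : nat) (g : n.-tuple {mpoly A[k]}).

(** The identity holds for constants and variables and is preserved by sums and products, hence it
    holds for all polynomials. *)
Lemma mderiv_comp_mpoly (f : {mpoly A[n]}) (j : 'I_k) :
  (f \mPo g)^`M(j) = \sum_i (f^`M(i) \mPo g) * (tnth g i)^`M(j).
Proof.
pose P f := (f \mPo g)^`M(j) = \sum_i (f^`M(i) \mPo g) * (tnth g i)^`M(j).
have PC c : P c%:MP.
  rewrite /P comp_mpolyC mderivC big1 // => i _.
  by rewrite mderivC comp_mpoly0 mul0r.
have PD f1 f2 : P f1 -> P f2 -> P (f1 + f2).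
  rewrite /P comp_mpolyD mderivD => -> ->; rewrite -big_split; apply: eq_bigr.
  by move=> i _; rewrite mderivD comp_mpolyD mulrDl.
have PM f1 f2 : P f1 -> P f2 -> P (f1 * f2).
  rewrite /P rmorphM /= mderivM => -> ->; rewrite mulr_suml mulr_sumr -big_split.
  apply: eq_bigr => i _; rewrite mderivM comp_mpolyD !rmorphM /= mulrDl.
  by rewrite mulrAC mulrA.
have PX i : P 'X_i.
  rewrite /P comp_mpolyXU (bigD1 i) //= big1 ?addr0 => [|l nli].
    rewrite mderivX mnm1E eqxx scale1r.
    have -> : (U_(i) - U_(i) = 0 :> 'X_{1..n})%MM.
      by apply/mnmP => l; rewrite mnmBE subnn mnm0E.
    by rewrite mpolyX0 comp_mpoly1 mul1r -tnth_nth.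
  by rewrite mderivX mnm1E eq_sym (negbTE nli) scale0r comp_mpoly0 mul0r.
elim/mpolyind: f => [|c m f _ _ Pf]; first exact: (PC 0).
apply: (PD) => //; rewrite -mul_mpolyC; apply: (PM) => //; rewrite mpolyXE_id.
apply: (big_ind P) => [|f1 f2|i _]; [exact: (PC 1) | exact: PM |].
by elim: (m i) => [|e IH]; [exact: (PC 1) | rewrite exprS; apply: (PM)].
Qed.

End ChainRule.

Section LinearSubstitution.
Variables (A : comNzRingType) (n : nat).
Implicit Types (f : {mpoly A[n]}) (g : 'M[A]_n).

(** The substitution of [act], for any ring and number of variables: it is applied to forms in
    [n.+1] coordinates and to polynomials in the [N * N] entries of a matrix. *)
Definition lsub g f : {mpoly A[n]} :=
  f \mPo [tuple \sum_(j < n) g i j *: 'X_j | i < n].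

Lemma lsubX g i : lsub g 'X_i = \sum_j g i j *: 'X_j.
Proof. by rewrite /lsub comp_mpolyXU -tnth_nth tnth_mktuple. Qed.

Lemma mderiv_lsub g f j : (lsub g f)^`M(j) = \sum_i g i j *: lsub g f^`M(i).
Proof.
rewrite /lsub mderiv_comp_mpoly; apply: eq_bigr => i _.
rewrite tnth_mktuple [X in _ * X]raddf_sum /= [X in _ * X](bigD1 j) //= big1 ?addr0 => [|l nlj].
  rewrite mderivZ mderivX mnm1E eqxx scale1r.
  have -> : (U_(j) - U_(j) = 0 :> 'X_{1..n})%MM.
    by apply/mnmP => l; rewrite mnmBE subnn mnm0E.
  by rewrite mpolyX0 mulrC -scalerAl mul1r.
by rewrite mderivZ mderivX mnm1E (negbTE nlj) scale0r scaler0.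
Qed.

End LinearSubstitution.

Section Apolar.
Variables (A : comNzRingType) (n : nat).
Implicit Types (h k : {mpoly A[n]}) (m : 'X_{1..n}).

Definition mfact m : nat := \prod_(i < n) (m i)`!.

(** The value at 0 of the differential operator [k(d/dx)] applied to [h]: distinct monomials are
    orthogonal, and [x^m] pairs with itself to [m!]. *)
Definition apolar k h : A := \sum_(m <- msupp k) k@_m * (mfact m)%:R * h@_m.

(** A range of summation independent of [k] makes linearity in [k] visible. *)
Lemma apolarwE w k h : (msize k <= w)%N ->
  apolar k h = \sum_(m : 'X_{1..n < w}) k@_m * (mfact m)%:R * h@_m.
Proof.
move=> le; rewrite /apolar (ssrcomplements.big_mksub ('X_{1..n < w} : subFinType _)) ?msupp_uniq //=.
  by rewrite big_rmcond //= => j /memN_msupp_eq0 ->; rewrite !mul0r.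
by move=> x /msize_mdeg_lt /leq_trans; apply.
Qed.

Lemma apolarDr k h1 h2 : apolar k (h1 + h2) = apolar k h1 + apolar k h2.
Proof.
by rewrite /apolar -big_split; apply: eq_bigr => m _; rewrite mcoeffD mulrDr.
Qed.

Lemma apolarZr k c h : apolar k (c *: h) = c * apolar k h.
Proof.
by rewrite /apolar mulr_sumr; apply: eq_bigr => m _; rewrite mcoeffZ mulrCA.
Qed.

Lemma apolar0r k : apolar k 0 = 0.
Proof. by rewrite -(scale0r 0) apolarZr mul0r. Qed.

Lemma apolar0l h : apolar 0 h = 0.
Proof. by rewrite /apolar msupp0 big_nil. Qed.

Lemma apolarDl k1 k2 h : apolar (k1 + k2) h = apolar k1 h + apolar k2 h.
Proof.
pose w := maxn (msize (k1 + k2)) (maxn (msize k1) (msize k2)).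
rewrite !(@apolarwE w) ?leq_max ?leqnn ?orbT // -big_split; apply: eq_bigr => m _.
by rewrite mcoeffD !mulrDl.
Qed.

Lemma apolarZl c k h : apolar (c *: k) h = c * apolar k h.
Proof.
pose w := maxn (msize (c *: k)) (msize k).
rewrite !(@apolarwE w) ?leq_max ?leqnn ?orbT // mulr_sumr; apply: eq_bigr => m _.
by rewrite mcoeffZ -!mulrA.
Qed.

Lemma apolar_suml (I : Type) (r : seq I) (F : I -> {mpoly A[n]}) h :
  apolar (\sum_(i <- r) F i) h = \sum_(i <- r) apolar (F i) h.
Proof.
by apply: (big_morph (apolar^~ h)) => [k1 k2|]; [apply: apolarDl | apply: apolar0l].
Qed.

Lemma apolar_sumr (I : Type) (r : seq I) k (F : I -> {mpoly A[n]}) :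
  apolar k (\sum_(i <- r) F i) = \sum_(i <- r) apolar k (F i).
Proof. by apply: (big_morph (apolar k)); [apply: apolarDr | apply: apolar0r]. Qed.

(** By bilinearity both arguments may be taken to be monomials, [k] being [x^m]; the rule is then
    [m! = m_i (m - e_i)!], both sides being 0 when [m_i = 0]. *)
Lemma apolarMX i k h : apolar k ('X_i * h) = apolar k^`M(i) h.
Proof.
elim/mpolyind: k => [|c m k _ _ IH]; first by rewrite mderiv0 !apolar0l.
rewrite mderivD mderivZ !apolarDl !apolarZl {}IH; congr (_ * _ + _) => {c k}.
elim/mpolyind: h => [|c m' h _ _ IH]; first by rewrite mulr0 !apolar0r.
rewrite mulrDr -scalerAr !apolarDr !apolarZr {}IH; congr (_ * _ + _) => {c h}.
rewrite -mpolyXD mderivX apolarZl /apolar !msuppX !big_seq1 !mcoeffX !eqxx !mul1r.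
case: (posnP (m i)) => [m0|mpos].
  rewrite m0 mul0r; case: eqP => [e|]; last by rewrite mulr0.
  by move: m0; rewrite -e mnmDE mnm1E eqxx.
have Um : (U_(i) <= m)%MM by rewrite lep1mP -lt0n.
have -> : (U_(i) + m' == m)%MM = (m' == m - U_(i))%MM.
  by rewrite -{1}(submK Um) addmC eqm_add2r.
rewrite mulrA eq_sym; congr (_ * _); rewrite -natrM; congr _%:R.
rewrite /mfact (bigD1 i) //= [in RHS](bigD1 i) //= mnmBE mnm1E eqxx subn1.
rewrite mulnA -{1 2}(prednK mpos) factS prednK //; congr muln.
by apply: eq_bigr => l nl; rewrite mnmBE mnm1E eq_sym (negbTE nl) subn0.
Qed.

Lemma apolar1 k : apolar k 1 = k@_0%MM.
Proof.
elim/mpolyind: k => [|c m k _ _ IH]; first by rewrite apolar0l mcoeff0.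
rewrite apolarDl apolarZl mcoeffD mcoeffZ IH; congr (_ * _ + _).
rewrite /apolar msuppX big_seq1 !mcoeffX eqxx mcoeff1 mul1r.
case: eqP => [->|]; rewrite ?mulr0 // mulr1 /mfact big1 // => i _.
by rewrite mnm0E.
Qed.

Lemma mcoeff0_lsub (g : 'M[A]_n) k : (lsub g k)@_0%MM = k@_0%MM.
Proof.
elim/mpolyind: k => [|c m k _ _ IH]; first by rewrite /lsub comp_mpoly0.
rewrite /lsub comp_mpolyD comp_mpolyZ -!/(lsub _ _) !mcoeffD !mcoeffZ IH.
congr (_ * _ + _) => {IH c k}; rewrite mcoeffX.
case: eqP => [->|/eqP nm]; first by rewrite mpolyX0 /lsub comp_mpoly1 mcoeff1 eqxx.
have [i mi]: exists i, m i != 0%N.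
  apply/existsP; apply: contraNT nm; rewrite negb_exists => /forallP h.
  by apply/eqP/mnmP => i; apply/eqP; rewrite mnm0E -[_ == _]negbK h.
rewrite -(@submK _ U_(i)%MM m) ?lep1mP // mpolyXD /lsub rmorphM /= -!/(lsub _ _).
rewrite lsubX rmorphM /= [X in _ * X](_ : _ = 0) ?mulr0 //.
rewrite raddf_sum big1 // => j _ /=.
by rewrite mcoeffZ mcoeffX mnm1_eq0 mulr0.
Qed.

(** Induction on the monomial [h]: a factor ['X_i] of [h] crosses the pairing as a derivation, and
    the chain rule for the substitution [g^T] produces the coefficients of [lsub g 'X_i]. *)
Lemma apolar_lsub g k h : apolar k (lsub g h) = apolar (lsub g^T k) h.
Proof.
pose P h := forall k, apolar k (lsub g h) = apolar (lsub g^T k) h.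
suff: P h by apply.
elim/mpolyind: h => [|c m h _ _ IH] {}k; first by rewrite /lsub comp_mpoly0 !apolar0r.
rewrite /lsub comp_mpolyD comp_mpolyZ -!/(lsub _ _) !apolarDr !apolarZr IH.
congr (_ * _ + _) => {IH c h}.
suff: P 'X_[m] by apply.
have PM i h : P h -> P ('X_i * h).
  move=> Ph {}k; rewrite apolarMX {1}/lsub rmorphM /= -!/(lsub _ _) lsubX.
  rewrite mulr_suml apolar_sumr mderiv_lsub apolar_suml.
  apply: eq_bigr => j _; rewrite -scalerAl apolarZr apolarMX Ph apolarZl.
  by rewrite mxE.
have P1 : P 1.
  by move=> {}k; rewrite /lsub comp_mpoly1 -!/(lsub _ _) !apolar1 mcoeff0_lsub.
rewrite mpolyXE_id.
have PE i e h : P h -> P ('X_i ^+ e * h).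
  by move=> Ph; elim: e => [|e IH]; rewrite ?mul1r // exprS -mulrA; apply: (PM).
elim: (index_enum _) => [|i r IH]; first by rewrite big_nil.
by rewrite big_cons; apply: (PE).
Qed.

End Apolar.

(** * Matrices acting on tensors *)

Section TensorAction.
Variables (A : comNzRingType) (N : nat) (J : finType).

(** [q] lists the coordinates of a tensor with one factor for each element of [J]; in the row-vector
    convention matrices act on the right. *)
Definition tact (q : {ffun J -> 'I_N} -> A) (g : 'M[A]_N) (t : {ffun J -> 'I_N}) : A :=
  \sum_s q s * \prod_l g (s l) (t l).

Lemma tactM q g h t : tact (tact q g) h t = tact q (g *m h) t.
Proof.
rewrite /tact; under eq_bigr do rewrite big_distrl /=.
rewrite exchange_big /=; apply: eq_bigr => s _.
under eq_bigr do rewrite -mulrA.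
rewrite -big_distrr /=; congr (_ * _).
under eq_bigr do rewrite -big_split /=.
rewrite -(bigA_distr_bigA (fun l j => g (s l) j * h j (t l))).
by apply: eq_bigr => l _; rewrite mxE.
Qed.

Lemma tact_diag q (d : 'rV[A]_N) t :
  tact q (diag_mx d) t = q t * \prod_l d 0 (t l).
Proof.
rewrite /tact (bigD1 t) //= [X in _ + X]big1 ?addr0 => [|s nst].
  by congr (_ * _); apply: eq_bigr => l _; rewrite mxE eqxx mulr1n.
have [l nl]: exists l, s l != t l.
  apply/existsP; apply: contraNT nst; rewrite negb_exists => /forallP h.
  by apply/eqP/ffunP => l; apply/eqP; rewrite -[_ == _]negbK h.
by rewrite (bigD1 l) //= mxE (negbTE nl) mulr0n mul0r mulr0.
Qed.

Lemma tact1 q t : tact q 1%:M t = q t.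
Proof.
rewrite -diag_const_mx tact_diag big1 ?mulr1 // => l _; exact: mxE.
Qed.

Lemma eq_tact q q' g : q =1 q' -> tact q g =1 tact q' g.
Proof. by move=> e t; apply: eq_bigr => s _; rewrite e. Qed.

End TensorAction.

Lemma rmorph_tact (A B : comNzRingType) (f : {rmorphism A -> B}) N (J : finType)
    (q : {ffun J -> 'I_N} -> A) g t :
  f (tact q g t) = tact (f \o q) (map_mx f g) t.
Proof.
rewrite rmorph_sum; apply: eq_bigr => s _; rewrite rmorphM rmorph_prod.
by congr (_ * _); apply: eq_bigr => l _; rewrite mxE.
Qed.

(** * Places with values in an algebraically closed field *)

Section Places.
Variables (K : fieldType) (C : closedFieldType).
Implicit Types (G : set (K * C)) (x : K) (c : C).

(** The graph of a ring morphism from a subring of [K] onto [C]; closed under subtraction, it is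
    single-valued as soon as 0 has no other value than 0. *)
Definition partial_place G :=
  [/\ G (1, 1),
      forall x y a b, G (x, a) -> G (y, b) -> G (x - y, a - b),
      forall x y a b, G (x, a) -> G (y, b) -> G (x * y, a * b),
      forall c, exists x, G (x, c)
    & forall c, G (0, c) -> c = 0].

Definition maximal_place G :=
  partial_place G /\
  forall H, partial_place H -> (forall p, G p -> H p) -> forall p, H p -> G p.

Lemma maximal_place_exists G0 : partial_place G0 ->
  exists2 G, maximal_place G & forall p, G0 p -> G p.
Proof.
move=> pG0.
pose P (A : set (K * C)) :=
  A = set0 \/ (forall p, G0 p -> A p) /\ partial_place A.
have [|A [PA Amax]] := @Zorn_bigcup _ P.
  move=> F FP Ftot.
  have [[A0 FA0 nA0]|F0] := pselect (exists2 A, F A & A <> set0); last first.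
    left; rewrite -subset0 => p [B FB Bp]; apply: F0; exists B => // B0.
    by move: Bp; rewrite B0.
  have Fp B p : F B -> B p -> partial_place B.
    by move=> FB Bp; have [B0|[]//] := FP _ FB; move: Bp; rewrite B0.
  have [A00|[subA0 pA0]] := FP _ FA0; first by case: nA0.
  have dir p q : (\bigcup_(X in F) X)%classic p -> (\bigcup_(X in F) X)%classic q ->
      exists2 B, F B & B p /\ B q.
    move=> [B FB Bp] [B' FB' Bq].
    by have [s|s] := Ftot _ _ FB FB'; [exists B' | exists B] => //; split => //; apply: s.
  right; split=> [p G0p|]; first by exists A0 => //; apply: subA0.
  have [h1 h2 h3 h4 h5] := pA0; split.
  - by exists A0.
  - move=> x y a b hx hy; have [B FB [Bx By]] := dir _ _ hx hy.
    by exists B => //; have [_ h _ _ _] := Fp _ _ FB Bx; apply: h.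
  - move=> x y a b hx hy; have [B FB [Bx By]] := dir _ _ hx hy.
    by exists B => //; have [_ _ h _ _] := Fp _ _ FB Bx; apply: h.
  - by move=> c; have [x Ax] := h4 c; exists x, A0.
  - by move=> c [B FB Bc]; have [_ _ _ _ h] := Fp _ _ FB Bc; apply: h.
have [A0|[subA pA]] := PA.
  case: (Amax G0); last by right.
  split=> [p|/(_ (1, 1))]; first by rewrite A0.
  by rewrite A0; apply; case: pG0.
exists A => //; split=> // H pH sH p Hp; have [//|nAp] := pselect (A p).
case: (Amax H); last by right; split=> // q /subA /sH.
by split=> [//|h]; apply: nAp; apply: h.
Qed.

Section PartialPlace.
Variables (G : set (K * C)) (pG : partial_place G).

Lemma place1 : G (1, 1). Proof. by case: pG. Qed.

Lemma placeB x y a b : G (x, a) -> G (y, b) -> G (x - y, a - b).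
Proof. by case: pG => _ h _ _ _; apply: h. Qed.

Lemma placeM x y a b : G (x, a) -> G (y, b) -> G (x * y, a * b).
Proof. by case: pG => _ _ h _ _; apply: h. Qed.

Lemma place0 : G (0, 0).
Proof. by have := placeB place1 place1; rewrite !subrr. Qed.

Lemma placeD x y a b : G (x, a) -> G (y, b) -> G (x + y, a + b).
Proof.
move=> Gx Gy; have := placeB Gx (placeB place0 Gy).
by rewrite !sub0r !opprK.
Qed.

Lemma place_fun x a b : G (x, a) -> G (x, b) -> a = b.
Proof.
move=> Ga Gb; have := placeB Ga Gb; rewrite subrr.
by case: pG => _ _ _ _ h /h /eqP; rewrite subr_eq0 => /eqP.
Qed.

Lemma place_sum (I : Type) (r : seq I) (P : pred I) (F : I -> K) (f : I -> C) :
  (forall i, P i -> G (F i, f i)) -> G (\sum_(i <- r | P i) F i, \sum_(i <- r | P i) f i).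
Proof.
move=> h; elim: r => [|i r IH]; first by rewrite !big_nil; apply: place0.
by rewrite !big_cons; case: ifP => // Pi; apply: placeD => //; apply: h.
Qed.

Lemma place_prod (I : Type) (r : seq I) (P : pred I) (F : I -> K) (f : I -> C) :
  (forall i, P i -> G (F i, f i)) -> G (\prod_(i <- r | P i) F i, \prod_(i <- r | P i) f i).
Proof.
move=> h; elim: r => [|i r IH]; first by rewrite !big_nil; apply: place1.
by rewrite !big_cons; case: ifP => // Pi; apply: placeM => //; apply: h.
Qed.

Lemma placeX x a n : G (x, a) -> G (x ^+ n, a ^+ n).
Proof.
move=> h; elim: n => [|n IH]; first by rewrite !expr0; apply: place1.
by rewrite !exprS; apply: placeM.
Qed.

Definition poly_place (P : {poly K}) (Q : {poly C}) := forall i, G (P`_i, Q`_i).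

Lemma poly_placeC x c : G (x, c) -> poly_place x%:P c%:P.
Proof. by move=> h i; rewrite !coefC; case: ifP => // _; apply: place0. Qed.

Lemma poly_placeX : poly_place 'X 'X.
Proof. by move=> i; rewrite !coefX; case: (i == 1%N); [apply: place1 | apply: place0]. Qed.

Lemma poly_placeB P P' Q Q' : poly_place P Q -> poly_place P' Q' ->
  poly_place (P - P') (Q - Q').
Proof. by move=> h h' i; rewrite !coefB; apply: placeB. Qed.

Lemma poly_placeM P P' Q Q' : poly_place P Q -> poly_place P' Q' ->
  poly_place (P * P') (Q * Q').
Proof. by move=> h h' i; rewrite !coefM; apply: place_sum => j _; apply: placeM. Qed.

Lemma poly_place_lift (Q : {poly C}) : exists P, poly_place P Q.
Proof.
have lift c : exists x, G (x, c) by case: pG.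
have [f Gf] := choice lift.
exists (\poly_(i < size Q) f Q`_i) => i; rewrite coef_poly; case: ltnP => // le.
by rewrite nth_default //; apply: place0.
Qed.

End PartialPlace.

Section MaximalPlace.
Variables (G : set (K * C)) (mG : maximal_place G).
Let pG : partial_place G := mG.1.

(** The assignment [P.[x] |-> Q.[c]], for [Q] a reduction of [P], extends [G]; the hypothesis makes
    it a place, and maximality puts [x] into the domain of [G]. *)
Lemma place_extend x c :
  (forall P Q, poly_place G P Q -> P.[x] = 0 -> Q.[c] = 0) -> G (x, c).
Proof.
move=> h; pose H : set (K * C) :=
  [set p | exists P, exists2 Q, poly_place G P Q & p = (P.[x], Q.[c])]%classic.
apply: (mG.2 H); last by exists 'X, 'X; [apply: poly_placeX | rewrite !hornerX].
  split.
  - exists 1%:P, 1%:P; last by rewrite !hornerC.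
    by apply: poly_placeC => //; apply: place1.
  - move=> u v a b [P [Q r [-> ->]]] [P' [Q' r' [-> ->]]].
    exists (P - P'), (Q - Q'); first exact: poly_placeB.
    by rewrite !hornerD !hornerN.
  - move=> u v a b [P [Q r [-> ->]]] [P' [Q' r' [-> ->]]].
    exists (P * P'), (Q * Q'); first exact: poly_placeM.
    by rewrite !hornerM.
  - move=> a; case: (pG) => _ _ _ /(_ a) [u Gu] _; exists u, u%:P, a%:P.
      exact: poly_placeC.
    by rewrite !hornerC.
  - by move=> a [P [Q r [/esym P0 ->]]]; apply: h r P0.
move=> [u a] Gu; exists u%:P, a%:P; first exact: poly_placeC.
by rewrite !hornerC.
Qed.

(** A relation [P.[x^-1] = 0] becomes, after multiplication by a power of [x], a relation among
    elements of the domain, which the place sends to [c^n * Q.[c^-1] = 0]. *)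
Lemma placeV x c : G (x, c) -> c != 0 -> G (x^-1, c^-1).
Proof.
move=> Gx c0.
have x0 : x != 0.
  by apply: contra_neq c0 => x0; apply: (place_fun pG Gx); rewrite x0; apply: place0.
apply: place_extend => P Q r P0; pose n := maxn (size P) (size Q).
have : G (x ^+ n * P.[x^-1], c ^+ n * Q.[c^-1]).
  rewrite (@horner_coef_wide _ n) ?leq_maxl // (@horner_coef_wide _ n) ?leq_maxr //.
  rewrite !mulr_sumr; apply: (place_sum pG) => i _.
  have e (F : fieldType) (p z : F) : z != 0 ->
      z ^+ n * (p * z^-1 ^+ i) = p * z ^+ (n - i).
    move=> z0; rewrite mulrCA exprVn -{1}(subnK (ltnW (ltn_ord i))) exprD.
    by rewrite mulfK // expf_neq0.
  by rewrite !e //; apply: placeM => //; apply: placeX.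
rewrite P0 mulr0 => h; have /eqP := place_fun pG h (place0 pG).
by rewrite mulf_eq0 expf_eq0 (negbTE c0) andbF /= => /eqP.
Qed.

(** The reductions [Q] of the polynomials vanishing at [x] form an ideal of [C[X]]. If it is 0, any
    value may be given to [x]; if it is proper, a root of a generator may; if it contains a
    constant, [x] satisfies a relation with coefficients in the kernel of the place. *)
Lemma place_algebraic x : (exists c, G (x, c)) \/
  exists2 U : {poly K}, (forall i, G (U`_i, 0)) & U.[x] = 1.
Proof.
pose inJ Q := exists2 P, poly_place G P Q & P.[x] = 0.
have [[Q [Q0 JQ]]|noJ] := pselect (exists Q, Q != 0 /\ inJ Q); last first.
  left; exists 0; apply: place_extend => P Q r P0.
  have [->|Q0] := eqVneq Q 0; first by rewrite hornerC.
  by case: noJ; exists Q; split=> //; exists P.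
pose szJ k := `[< exists Q, [/\ Q != 0, inJ Q & size Q = k] >].
have exJ : exists k, szJ k by exists (size Q); apply/asboolP; exists Q.
case: (ex_minnP exJ) => k /asboolP[{Q0 JQ}Q [Q0 [P r P0] szQ]] kmin.
have [sz1|sz1] := boolP (size Q == 1%N).
  right; have /size_poly1P[c c0 Qc] := sz1.
  case: (pG) => _ _ _ /(_ c^-1) [u Gu] _.
  exists (1 - u%:P * P); last by rewrite hornerD hornerN hornerM P0 mulr0 subr0 hornerC.
  have r' : poly_place G (1 - u%:P * P) (1 - (c^-1)%:P * Q).
    apply: poly_placeB => //; first by apply: poly_placeC => //; apply: place1.
    by apply: poly_placeM => //; apply: poly_placeC.
  move: r'; rewrite Qc -polyCM mulVf // subrr => r' i.
  by have := r' i; rewrite coef0.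
left; have /closed_rootP[c rc] := sz1; exists c.
apply: place_extend => P' Q' r' P'0.
(* The remainder modulo [Q] is again the reduction of a polynomial vanishing at [x], so by
   minimality of [Q] it is 0. *)
have [D rD] := poly_place_lift pG (Q' %/ Q).
have rR : poly_place G (P' - D * P) (Q' %% Q).
  have -> : Q' %% Q = Q' - (Q' %/ Q) * Q by rewrite {2}(divp_eq Q' Q) addrC addKr.
  by apply: poly_placeB => //; apply: poly_placeM.
have [R0|nR0] := eqVneq (Q' %% Q) 0.
  by rewrite (divp_eq Q' Q) R0 addr0 hornerM (rootP rc) mulr0.
have /kmin : szJ (size (Q' %% Q)).
  apply/asboolP; exists (Q' %% Q); split => //; exists (P' - D * P) => //.
  by rewrite hornerD hornerN hornerM P0 P'0 mulr0 subr0.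
by rewrite -szQ leqNgt ltn_modp Q0.
Qed.

Let bad x d := exists U : {poly K},
  [/\ forall i, G (U`_i, 0), (size U <= d.+1)%N & U.[x] = 1].

(** [bad x d] is a relation of degree at most [d] writing 1 as a polynomial in [x] with coefficients
    in the kernel of the place. The relation for [x^-1] expresses the top power of [x] by lower
    ones, so [d] can be lowered; the descent on [d + e] stops at degree 0, where 1 would be in the
    kernel. *)
Lemma place_no_relation x d e : x != 0 -> (e <= d)%N -> bad x d -> bad x^-1 e -> False.
Proof.
have [s] := ubnP (d + e)%N; elim: s x d e => // s IH x d e le_s x0 ed.
move=> [U [GU sU U1]] [W [GW sW W1]].
case: e => [|e] in le_s ed sW *.
  move: W1; rewrite (size1_polyC sW) hornerC => W1.
  have := GW 0%N; rewrite W1 => h; have /eqP := place_fun pG h (place1 pG).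
  by rewrite eq_sym oner_eq0.
case: d => // d in le_s ed sU *.
(* The constant term [W_0] is sent to 0, so [1 - W_0] is sent to 1 and its inverse [v] is in the
   domain. *)
have G1 : G (1 - W`_0, 1) by rewrite -[X in G (_, X)]subr0; apply: placeB => //; apply: place1.
have w0 : 1 - W`_0 != 0.
  apply/eqP => w0; move: G1; rewrite w0 => h; have /eqP := place_fun pG h (place0 pG).
  by rewrite oner_eq0.
have GV : G ((1 - W`_0)^-1, 1) by have := placeV G1 (oner_neq0 _); rewrite invr1.
pose v := (1 - W`_0)^-1.
(* Here [x^(d+1)] is replaced by [v * \sum_(j >= 1) W_j x^(d+1-j)]; no negative power occurs since
   [W] has degree at most [d+1]. *)
pose U' := \poly_(i < d.+1) (U`_i + U`_d.+1 * (v * W`_(d.+1 - i))).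
have GU' i : G (U'`_i, 0).
  rewrite coef_poly; case: ifP => _; last exact: place0.
  rewrite -[X in G (_, X)](addr0 0) -[X in G (_, _ + X)](mul0r 0).
  apply: placeD => //; apply: placeM => //.
  by rewrite -[X in G (_, X)](mulr0 1); apply: placeM.
have sU' : (size U' <= d.+1)%N := size_poly _ _.
have U'1 : U'.[x] = 1.
  rewrite (horner_coef_wide _ sU') -[RHS]U1 (horner_coef_wide _ sU) [RHS]big_ord_recr /=.
  have -> : \sum_(i < d.+1) U'`_i * x ^+ i = \sum_(i < d.+1) U`_i * x ^+ i +
      U`_d.+1 * v * \sum_(i < d.+1) W`_(d.+1 - i) * x ^+ i.
    rewrite mulr_sumr -big_split; apply: eq_bigr => i _ /=.
    by rewrite coef_poly ltn_ord mulrDl !mulrA.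
  congr (_ + _); rewrite -mulrA; congr (_ * _).
  have sW' : (size W <= d.+2)%N by apply: leq_trans sW _; rewrite ltnS.
  have : 1 - W`_0 = \sum_(j < d.+1) W`_j.+1 * x^-1 ^+ j.+1.
    rewrite -W1 (horner_coef_wide _ sW') big_ord_recl expr0 mulr1 addrC addKr.
    by apply: eq_bigr => j _; rewrite lift0.
  rewrite (reindex_inj rev_ord_inj) /= => e1.
  apply: (mulfI w0); rewrite mulrA mulfV // mul1r {1}e1 mulr_suml.
  apply: eq_bigr => i _.
  have -> : (d.+1 - i.+1).+1 = (d.+1 - i)%N by rewrite subSS subSn // -ltnS.
  rewrite -mulrA; congr (_ * _); rewrite exprVn.
  apply: (mulfI (expf_neq0 (d.+1 - i) x0)).
  by rewrite mulrA mulfV ?expf_neq0 // mul1r -exprD subnK // ltnW.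
have bU' : bad x d by exists U'.
have bW : bad x^-1 e.+1 by exists W.
have [le|lt] := leqP e.+1 d; first by apply: (IH x d e.+1) => //; rewrite addSn ltnS in le_s.
(* The relation for [x] now has the smaller degree bound, so [x] and [x^-1] exchange roles. *)
apply: (IH x^-1 e.+1 d); rewrite ?invr_eq0 ?invrK //; last exact: ltnW.
by rewrite addnC; rewrite addSn ltnS in le_s.
Qed.

(** If neither [x] nor [x^-1] had a value, both would satisfy relations that exclude each other: the
    domain of a maximal place is a valuation ring. *)
Lemma place_total x : x != 0 -> (exists c, G (x, c)) \/ (exists c, G (x^-1, c)).
Proof.
move=> x0; have [?|[U GU U1]] := place_algebraic x; first by left.
have [?|[W GW W1]] := place_algebraic x^-1; first by right.
have bU : bad x (size U) by exists U; split.
have bW : bad x^-1 (size W) by exists W; split.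
have [le|/ltnW le] := leqP (size W) (size U).
  by case: (place_no_relation x0 le bU bW).
by case: (@place_no_relation x^-1 _ _ _ le bW); rewrite ?invr_eq0 ?invrK.
Qed.

End MaximalPlace.
End Places.

(** * Integral weights *)

Section Gordan.

Lemma seq_max (s : seq rat) : s != [::] -> exists2 m, m \in s & {in s, forall y, y <= m}.
Proof.
elim: s => // x [|x' s] IH _; first by exists x => [|y]; rewrite inE // => /eqP ->.
have [//|m ms mP] := IH; have [le|lt] := leP x m.
  exists m => [|y]; first by rewrite inE ms orbT.
  by rewrite inE => /orP[/eqP ->|/mP].
exists x => [|y]; first by rewrite mem_head.
by rewrite inE => /orP[/eqP ->|/mP /le_trans->] //; apply: ltW.
Qed.

Lemma seq_between (s t : seq rat) :
  {in s & t, forall x y, x < y} ->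
  exists z, {in s, forall x, x < z} /\ {in t, forall y, z < y}.
Proof.
move=> st; have [->|/seq_max[m ms mP]] := eqVneq s [::].
  have [->|t0] := eqVneq t [::]; first by exists 0.
  have [|m mt mP] := @seq_max (map -%R t); first by case: (t) t0.
  exists (- m - 1); split=> // y yt.
  by have := mP _ (map_f -%R yt); lra.
have [->|t0] := eqVneq t [::].
  by exists (m + 1); split=> // x /mP; lra.
have [|m' mt' mP'] := @seq_max (map -%R t); first by case: (t) t0.
move: mt' mP' => /mapP[m'' mt'' ->] mP''; have lt := st _ _ ms mt''.
exists ((m + m'') / 2%:R); split=> [x /mP|y yt]; first by lra.
by have := mP'' _ (map_f -%R yt); lra.
Qed.

(* Fourier-Motzkin elimination of the first coordinate. *)
Lemma gordan N (Pos : 'rV[int]_N -> Prop) (s : seq 'rV[int]_N) :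
  (forall c c', Pos c -> Pos c' -> Pos (c + c')) -> ~ Pos 0 ->
  (forall c, c \in s -> Pos c) ->
  exists a : 'cV[int]_N, {in s, forall c, 0 < (c *m a) 0 0}.
Proof.
elim: N Pos s => [|N IH] Pos s PD P0 Ps.
  by exists 0 => c /Ps; rewrite (thinmx0 c) => /P0.
rewrite -[N.+1]/(1 + N)%N in Pos s PD P0 Ps *.
have PMn c e : Pos c -> Pos (c *+ e.+1).
  by move=> Pc; elim: e => // e IHe; rewrite mulrS; apply: PD.
pose hd (c : 'rV[int]_(1 + N)) : int := c 0 0.
(* For [p] in [sp] and [q] in [sn], a combination with positive coefficients whose first coordinate
   cancels. *)
pose comb (p q : 'rV[int]_(1 + N)) := p *+ `|hd q|%N + q *+ `|hd p|%N.
pose sp := [seq c <- s | 0 < hd c]; pose sn := [seq c <- s | hd c < 0].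
pose s' := [seq rsubmx c | c <- [seq c <- s | hd c == 0]] ++
           [seq rsubmx (comb p q) | p <- sp, q <- sn].
pose Pos' c := Pos (row_mx (0 : 'rV[int]_1) c).
have hd0 c : hd c = 0 -> row_mx (0 : 'rV[int]_1) (rsubmx c) = c.
  move=> h; rewrite -{2}[c]hsubmxK; congr row_mx; apply/rowP => i.
  by rewrite !mxE !ord1 -h /hd; congr (c _ _); apply: val_inj.
have [|||a' a'P] := IH Pos' s'.
- move=> c c'; rewrite /Pos' => h /(PD _ _ h).
  by rewrite add_row_mx addr0.
- by rewrite /Pos' row_mx0.
- move=> c'; rewrite mem_cat => /orP[/mapP[c]|/allpairsP[[p q] /= []]].
    by rewrite mem_filter => /andP[/eqP h /Ps Pc] ->; rewrite /Pos' hd0.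
  rewrite !mem_filter => /andP[hp /Ps Pp] /andP[hq /Ps Pq] ->.
  rewrite /Pos' hd0; last first.
    rewrite /comb /hd mxE !mulmxnE -!/(hd _) -[hd p *+ _]mulr_natr -[hd q *+ _]mulr_natr.
    rewrite !natz !abszE.
    by rewrite (gtr0_norm hp) (ltr0_norm hq); ring.
  rewrite /comb; have [e ->] : exists e, `|hd q|%N = e.+1 by exists `|hd q|.-1%N; lia.
  have [e' ->] : exists e, `|hd p|%N = e.+1 by exists `|hd p|.-1%N; lia.
  by apply: PD; apply: PMn.
pose tl (c : 'rV[int]_(1 + N)) : int := (rsubmx c *m a') 0 0.
have tlD c c' : tl (c + c') = tl c + tl c' by rewrite /tl raddfD mulmxDl mxE.
have tlMn c e : tl (c *+ e) = tl c *+ e.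
  by rewrite /tl raddfMn /= -scaler_nat -scalemxAl mxE mulr_natl.
(* The first weight [z] has a lower bound from each element of [sp] and an upper bound from each
   element of [sn]; the inequalities for the [comb p q] say that these bounds are compatible. *)
have [z [zp zn]] : exists z : rat,
    {in [seq - (tl c)%:~R / (hd c)%:~R | c <- sp], forall x, x < z} /\
    {in [seq - (tl c)%:~R / (hd c)%:~R | c <- sn], forall x, z < x}.
  apply: seq_between => _ _ /mapP[p hp ->] /mapP[q hq ->].
  have : rsubmx (comb p q) \in s' by rewrite mem_cat; apply/orP; right; apply: allpairs_f.
  move: hp hq; rewrite !mem_filter => /andP[hp _] /andP[hq _] /a'P.
  rewrite -/(tl _) /comb tlD !tlMn -[tl p *+ _]mulr_natr -[tl q *+ _]mulr_natr !natz !abszE (gtr0_norm hp) (ltr0_norm hq).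
  rewrite -(ltr_int rat) !rmorphD !rmorphM /= rmorphN /=.
  move: hp hq; rewrite -(ltr_int rat) -(ltr_int rat) => hp hq h.
  by rewrite ltr_pdivrMr // mulrAC ltr_ndivlMr //; lra.
(* Multiplying by the denominator of [z] makes the weights integral and keeps the signs. *)
exists (col_mx (numq z)%:M (denq z *: a')) => c cs.
have -> : (c *m col_mx (numq z)%:M (denq z *: a')) 0 0 = hd c * numq z + denq z * tl c.
  rewrite -{1}[c]hsubmxK mul_row_col mxE -scalemxAr [in X in _ + X]mxE -/(tl c).
  congr (_ + _); rewrite mul_mx_scalar mxE mulrC mxE; congr (c _ _ * _).
  exact: val_inj.
rewrite -(ltr_int rat) rmorphD !rmorphM /=.
have dz : 0 < (denq z)%:~R :> rat by rewrite ltr0z denq_gt0.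
rewrite numqE.
suff : 0 < (hd c)%:~R * z + (tl c)%:~R.
  by move=> /(mulr_gt0 dz); rewrite mulrDr [_ * (_ * z)]mulrCA [_ * z]mulrC.
have [h|h|h] := ltgtP (hd c) 0.
- have /zn : - (tl c)%:~R / (hd c)%:~R \in [seq - (tl c)%:~R / (hd c)%:~R : rat | c <- sn].
    by apply: (map_f (fun c => - (tl c)%:~R / (hd c)%:~R)); rewrite mem_filter h.
  by rewrite ltr_ndivlMr ?ltrz0 //; lra.
- have /zp : - (tl c)%:~R / (hd c)%:~R \in [seq - (tl c)%:~R / (hd c)%:~R : rat | c <- sp].
    by apply: (map_f (fun c => - (tl c)%:~R / (hd c)%:~R)); rewrite mem_filter h.
  by rewrite ltr_pdivrMr ?ltr0z //; lra.
- rewrite h mul0r add0r ltr0z; apply: a'P; rewrite mem_cat map_f //.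
  by rewrite mem_filter h eqxx.
Qed.

End Gordan.

(** * Smith form over a valuation ring *)

Section Smith.
Variables (K : fieldType) (C : closedFieldType) (G : set (K * C)).
Hypothesis mG : maximal_place G.
Let pG : partial_place G := mG.1.

Definition valring x := exists c, G (x, c).
Definition valdvd x y := exists2 o, valring o & y = o * x.
Definition valmx m n (A : 'M[K]_(m, n)) := forall i j, valring (A i j).
Definition valGL n (A : 'M[K]_n) := exists A', [/\ A *m A' = 1%:M, valmx A & valmx A'].

Lemma valring0 : valring 0. Proof. by exists 0; apply: place0. Qed.
Lemma valring1 : valring 1. Proof. by exists 1; apply: place1. Qed.
Lemma valringN x : valring x -> valring (- x).
Proof. by move=> [c Gc]; exists (0 - c); rewrite -sub0r; apply: placeB => //; apply: place0. Qed.
Lemma valringD x y : valring x -> valring y -> valring (x + y).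
Proof. by move=> [a ha] [b hb]; exists (a + b); apply: placeD. Qed.
Lemma valringM x y : valring x -> valring y -> valring (x * y).
Proof. by move=> [a ha] [b hb]; exists (a * b); apply: placeM. Qed.
Lemma valring_sum (I : Type) (r : seq I) (P : pred I) F :
  (forall i, P i -> valring (F i)) -> valring (\sum_(i <- r | P i) F i).
Proof. by move=> h; apply: big_ind => //; [apply: valring0 | apply: valringD]. Qed.
Lemma valring_prod (I : Type) (r : seq I) (P : pred I) F :
  (forall i, P i -> valring (F i)) -> valring (\prod_(i <- r | P i) F i).
Proof. by move=> h; apply: big_ind => //; [apply: valring1 | apply: valringM]. Qed.

Lemma valdvd_total x y : valdvd x y \/ valdvd y x.
Proof.
have [->|x0] := eqVneq x 0; first by right; exists 0; [apply: valring0 | rewrite mul0r].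
have [->|y0] := eqVneq y 0; first by left; exists 0; [apply: valring0 | rewrite mul0r].
have [|h|h] := place_total mG (_ : x / y != 0); first by rewrite mulf_neq0 ?invr_eq0.
  by right; exists (x / y); rewrite ?divfK.
by left; exists (y / x); rewrite ?divfK // -invf_div.
Qed.

Lemma valdvd_trans y x z : valdvd x y -> valdvd y z -> valdvd x z.
Proof.
move=> [o vo ->] [o' vo' ->]; exists (o' * o); last by rewrite mulrA.
exact: valringM.
Qed.

Lemma val_pivot (s : seq K) : s != [::] -> exists2 x, x \in s & {in s, forall y, valdvd x y}.
Proof.
have refl x : valdvd x x by exists 1; rewrite ?mul1r //; apply: valring1.
elim: s => // x [|x' s] IH _; first by exists x => [|y]; rewrite inE // => /eqP ->.
have [//|m ms mP] := IH; have [xm|mx] := valdvd_total x m.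
  exists x => [|y]; first by rewrite mem_head.
  by rewrite inE => /orP[/eqP ->|/mP /(valdvd_trans xm)].
exists m => [|y]; first by rewrite inE ms orbT.
by rewrite inE => /orP[/eqP ->|/mP].
Qed.

Lemma valmx0 m n : valmx (0 : 'M_(m, n)).
Proof. by move=> i j; rewrite mxE; apply: valring0. Qed.
Lemma valmx1 n : valmx (1%:M : 'M_n).
Proof. by move=> i j; rewrite mxE; case: (i == j); [apply: valring1 | apply: valring0]. Qed.
Lemma valmxM m n p (A : 'M_(m, n)) (B : 'M_(n, p)) : valmx A -> valmx B -> valmx (A *m B).
Proof. by move=> h h' i j; rewrite mxE; apply: valring_sum => l _; apply: valringM. Qed.
Lemma valmxN m n (A : 'M_(m, n)) : valmx A -> valmx (- A).
Proof. by move=> h i j; rewrite mxE; apply: valringN. Qed.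
Lemma valmx_block m1 m2 n1 n2 (A : 'M_(m1, n1)) (B : 'M_(m1, n2)) (D : 'M_(m2, n1)) (E : 'M_(m2, n2)) :
  valmx A -> valmx B -> valmx D -> valmx E -> valmx (block_mx A B D E).
Proof.
move=> hA hB hD hE i j; rewrite !mxE; case: split => k; rewrite mxE; by case: split => l.
Qed.

Lemma valGLM n (A B : 'M[K]_n) : valGL A -> valGL B -> valGL (A *m B).
Proof.
move=> [A' [AA' vA vA']] [B' [BB' vB vB']]; exists (B' *m A'); split; try exact: valmxM.
by rewrite mulmxA -(mulmxA A) BB' mulmx1.
Qed.

Lemma valGL1 n : valGL (1%:M : 'M_n).
Proof. by exists 1%:M; rewrite mulmx1; split=> //; apply: valmx1. Qed.

Lemma valGL_tperm n (i j : 'I_n) : valGL (tperm_mx i j).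
Proof.
exists (tperm_mx i j); rewrite -perm_mxM tperm2 perm_mx1.
by split=> // k l; rewrite !mxE; case: (_ == _); [apply: valring1 | apply: valring0
  | apply: valring1 | apply: valring0].
Qed.

Lemma valGL_diag m n (A : 'M_m) (B : 'M_n) : valGL A -> valGL B -> valGL (block_mx A 0 0 B).
Proof.
move=> [A' [AA' vA vA']] [B' [BB' vB vB']]; exists (block_mx A' 0 0 B'); split.
- by rewrite mulmx_block !mulmx0 !mul0mx !addr0 add0r AA' BB' -scalar_mx_block.
- by apply: valmx_block => //; apply: valmx0.
- by apply: valmx_block => //; apply: valmx0.
Qed.

Lemma valGL_lower m n (A : 'M_(n, m)) : valmx A -> valGL (block_mx 1%:M 0 A 1%:M).
Proof.
move=> vA; exists (block_mx 1%:M 0 (- A) 1%:M); split.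
- rewrite mulmx_block !mulmx0 !mul0mx !mulmx1 !mul1mx !addr0 add0r subrr.
  by rewrite -scalar_mx_block.
- by apply: valmx_block => //; [apply: valmx1 | apply: valmx0 | apply: valmx1].
- by apply: valmx_block => //; [apply: valmx1 | apply: valmx0 | apply: valmxN | apply: valmx1].
Qed.

Lemma valGL_upper m n (A : 'M_(m, n)) : valmx A -> valGL (block_mx 1%:M A 0 1%:M).
Proof.
move=> vA; exists (block_mx 1%:M (- A) 0 1%:M); split.
- rewrite mulmx_block !mulmx0 !mul0mx !mulmx1 !mul1mx !addr0 add0r addNr.
  by rewrite -scalar_mx_block.
- by apply: valmx_block => //; [apply: valmx1 | apply: valmx0 | apply: valmx1].
- by apply: valmx_block => //; [apply: valmx1 | apply: valmxN | apply: valmx0 | apply: valmx1].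
Qed.

(** Gaussian elimination without denominators: an entry of least valuation divides all others, so
    clearing its row and column takes multipliers in the valuation ring. *)
Lemma val_smith n (B : 'M[K]_n) :
  exists L d U, [/\ valGL L, valGL U & B = L *m diag_mx d *m U].
Proof.
elim: n B => [|n IH] B.
  by exists 1%:M, 0, 1%:M; split; [exact: valGL1 | exact: valGL1 | rewrite thinmx0; apply/esym/thinmx0].
have [->|B0] := eqVneq B 0.
  exists 1%:M, 0, 1%:M; split; [exact: valGL1 | exact: valGL1 |].
  by rewrite (_ : diag_mx 0 = 0) ?mulmx0 ?mul0mx // raddf0.
have [|x /allpairsP[[i0 j0] /= [_ _ xE]] xP] :=
  @val_pivot [seq B i j | i <- enum 'I_n.+1, j <- enum 'I_n.+1].
  by rewrite -size_eq0 size_allpairs size_enum_ord.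
have dvdB i j : valdvd x (B i j) by apply: xP; apply: allpairs_f; rewrite mem_enum.
have x0 : x != 0.
  apply: contra_neq B0 => x0; apply/matrixP => i j; rewrite mxE.
  by have [o _ ->] := dvdB i j; rewrite x0 mulr0.
pose B1 : 'M_(1 + n) := xrow ord0 i0 (xcol ord0 j0 B).
have dvdB1 i j : valring (x^-1 * B1 i j).
  by rewrite !mxE; have [o vo ->] := dvdB (tperm ord0 i0 i) (tperm ord0 j0 j); rewrite mulrCA mulVf // mulr1.
have B100 : ulsubmx B1 = x%:M.
  apply/matrixP => i j; rewrite !ord1 !mxE eqxx mulr1n xE.
  have l0 : lshift n (ord0 : 'I_1) = (ord0 : 'I_n.+1) by apply: val_inj.
  by rewrite -/(lshift n ord0) l0 !tpermL.
pose r := x^-1 *: ursubmx B1; pose c := x^-1 *: dlsubmx B1.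
have vr : valmx r by move=> i j; rewrite 3!mxE; apply: dvdB1.
have vc : valmx c by move=> i j; rewrite 3!mxE; apply: dvdB1.
(* The induction hypothesis is applied to the Schur complement of the pivot. *)
have [L2 [d2 [U2 [vL2 vU2 eD]]]] := IH (drsubmx B1 - x *: (c *m r)).
have eB1 : B1 = (block_mx 1%:M 0 c 1%:M *m block_mx 1%:M 0 0 L2) *m
    diag_mx (row_mx (const_mx x : 'rV_1) d2) *m (block_mx 1%:M 0 0 U2 *m block_mx 1%:M r 0 1%:M).
  rewrite diag_mx_row diag_const_mx !mulmx_block.
  rewrite !(mulmx0, mul0mx, mulmx1, mul1mx, addr0, add0r).
  rewrite -[LHS]submxK B100 -eD mul_scalar_mx mul_mx_scalar -scalemxAl addrCA subrr addr0.
  by rewrite !scalerA mulfV // !scale1r.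
exists (tperm_mx ord0 i0 *m (block_mx 1%:M 0 c 1%:M *m block_mx 1%:M 0 0 L2 : 'M_(1 + n))).
exists (row_mx (const_mx x : 'rV_1) d2 : 'rV_(1 + n)).
exists ((block_mx 1%:M 0 0 U2 *m block_mx 1%:M r 0 1%:M : 'M_(1 + n)) *m tperm_mx ord0 j0); split.
- apply: valGLM; [exact: valGL_tperm | apply: valGLM].
    exact: (@valGL_lower 1 n).
  by apply: (@valGL_diag 1 n) => //; apply: valGL1.
- apply: valGLM; [apply: valGLM | exact: valGL_tperm].
    by apply: (@valGL_diag 1 n) => //; apply: valGL1.
  exact: (@valGL_upper 1 n).
have tt k : tperm_mx ord0 k *m tperm_mx ord0 k = 1%:M :> 'M[K]_n.+1.
  by rewrite -perm_mxM tperm2 perm_mx1.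
have -> : B = tperm_mx ord0 i0 *m B1 *m tperm_mx ord0 j0.
  by rewrite /B1 xrowE xcolE !mulmxA tt mul1mx -mulmxA tt mulmx1.
by rewrite {1}eB1 !mulmxA.
Qed.

End Smith.

(** * The Reynolds operator *)

Section GenericMatrix.
Variable N : nat.

Definition varmx (A : comNzRingType) : 'M[{mpoly A[N * N]}]_N :=
  \matrix_(i, j) 'X_(mxvec_index i j).

Lemma det_varmx_neq0 (A : comNzRingType) : \det (varmx A) != 0.
Proof.
apply/eqP => /(congr1 (meval (fun a => mxvec (1%:M : 'M[A]_N) 0 a))).
rewrite meval0 -det_map_mx (_ : map_mx _ _ = 1%:M) ?det1; last first.
  apply/matrixP => i j; rewrite [LHS]mxE [varmx _ _ _]mxE /=. by rewrite mevalXU mxvecE.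
by move/eqP; rewrite oner_eq0.
Qed.

(** The matrix of [B |-> g *m B] on flattened matrices; [lsub] by it replaces the generic matrix [X]
    by [g *m X]. *)
Definition left_mulmx_mx (A : comNzRingType) (g : 'M[A]_N) : 'M[A]_(N * N) :=
  \matrix_(a, b) mxvec (g *m vec_mx (delta_mx 0 b)) 0 a.

Lemma left_mulmx_mxE (A : comNzRingType) (g : 'M[A]_N) i j b :
  left_mulmx_mx g (mxvec_index i j) b = \sum_k g i k * (mxvec_index k j == b)%:R.
Proof.
by rewrite mxE mxvecE mxE; apply: eq_bigr => k _; rewrite !mxE eqxx.
Qed.

Lemma mxvec_index_eq (i j k l : 'I_N) :
  (mxvec_index i j == mxvec_index k l) = (i == k) && (j == l).
Proof.
apply/eqP/andP => [|[/eqP-> /eqP->] //].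
case: (curry_mxvec_bij N N) => f fK _ e.
have := fK (i, j) isT; have := fK (k, l) isT; rewrite /= e => ->.
by case=> -> ->.
Qed.

(** Thus the apolar adjoint of a left multiplication is again a left multiplication. *)
Lemma tr_left_mulmx_mx (A : comNzRingType) (g : 'M[A]_N) :
  (left_mulmx_mx g)^T = left_mulmx_mx g^T.
Proof.
apply/matrixP => b a; rewrite mxE.
case/mxvec_indexP: a => i j; case/mxvec_indexP: b => k l; rewrite !left_mulmx_mxE.
rewrite (bigD1 k) //= big1 => [|k' nk]; last by rewrite mxvec_index_eq (negbTE nk) mulr0.
rewrite [RHS](bigD1 i) //= big1 => [|k' nk]; last by rewrite mxvec_index_eq (negbTE nk) mulr0.
by rewrite !mxvec_index_eq !eqxx mxE eq_sym.
Qed.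

Lemma lsub_varmx (A : comNzRingType) (g : 'M[A]_N) :
  map_mx (lsub (left_mulmx_mx g)) (varmx A) = map_mx (@mpolyC (N * N) A) g *m varmx A.
Proof.
apply/matrixP => i j; rewrite !mxE lsubX.
under eq_bigr do rewrite left_mulmx_mxE scaler_suml.
rewrite exchange_big; apply: eq_bigr => k _ /=; rewrite !mxE.
rewrite (bigD1 (mxvec_index k j)) //= big1 => [|b nb].
  by rewrite eqxx mulr1 addr0 mul_mpolyC.
by rewrite eq_sym (negbTE nb) mulr0 scale0r.
Qed.

End GenericMatrix.

Section Reynolds.
Variables (C : numClosedFieldType) (N : nat) (J : finType).
Local Notation TI := {ffun J -> 'I_N}.
Local Notation M := #|{ffun J -> 'I_N}|.

(* The homogenization by [\det B] of [Q] evaluated at the fractions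
   [tact q B s ^+ N / \det B ^+ #|J|], which are of degree 0 in [B]. *)
Definition homdet (A : comNzRingType) (iota : C -> A) (Q : {mpoly C[M]})
    (q : TI -> A) (B : 'M[A]_N) : A :=
  \sum_(m <- msupp Q) iota Q@_m * \det B ^+ (#|J| * (msize Q - mdeg m)) *
     \prod_s tact q B (enum_val s) ^+ (N * m s).

Lemma rmorph_homdet (A A' : comNzRingType) (f : {rmorphism A -> A'}) iota Q q B :
  f (homdet iota Q q B) = homdet (f \o iota) Q (f \o q) (map_mx f B).
Proof.
rewrite rmorph_sum; apply: eq_bigr => m _; rewrite !rmorphM rmorphXn rmorph_prod /=.
rewrite det_map_mx; congr (_ * _); apply: eq_bigr => s _.
by rewrite rmorphXn rmorph_tact.
Qed.

Lemma eq_homdet_tact (A : comNzRingType) (i : C -> A) Q q q' B B' :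
  \det B = \det B' -> tact q B =1 tact q' B' -> homdet i Q q B = homdet i Q q' B'.
Proof.
move=> eB eq; apply: eq_bigr => m _; rewrite eB; congr (_ * _).
by apply: eq_bigr => s _; rewrite eq.
Qed.

Lemma eq_homdet (A : comNzRingType) (i i' : C -> A) Q q q' B :
  i =1 i' -> q =1 q' -> homdet i Q q B = homdet i' Q q' B.
Proof.
move=> ei eq; transitivity (homdet i' Q q B).
  by apply: eq_bigr => m _; rewrite ei.
by apply: eq_homdet_tact => // s; apply: eq_tact.
Qed.

Let X := varmx N C.
(** At the generic matrix this is a form of degree [N * #|J| * msize Q] in the entries; [kk Q] is
    the power of [\det X] of that degree. *)
Let hgen (Q : {mpoly C[M]}) (q : TI -> C) : {mpoly C[N * N]} :=
  homdet (@mpolyC (N * N) C) Q (@mpolyC (N * N) C \o q) X.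
Let kk (Q : {mpoly C[M]}) : {mpoly C[N * N]} := \det X ^+ (#|J| * msize Q).

Let lsub_kk Q (g : 'M[C]_N) : \det g = 1 -> lsub (left_mulmx_mx g) (kk Q) = kk Q.
Proof.
move=> g1; rewrite /kk /lsub rmorphXn -det_map_mx /= -/(lsub _) lsub_varmx.
by rewrite det_mulmx det_map_mx g1 rmorph1 mul1r.
Qed.

(** The coefficients [c_m] of [kk Q] are integers, so the value is a sum of terms [m! * c_m^2], and
    the leading monomial contributes a positive one. *)
Lemma apolar_kk_gt0 Q : 0 < apolar (kk Q) (kk Q).
Proof.
have kR m : (kk Q)@_m \is Num.real.
  have -> : kk Q = map_mpoly intr (\det (varmx N int) ^+ (#|J| * msize Q)).
    have e : X = map_mx (map_mpoly intr) (varmx N int).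
      by apply/matrixP => i j; rewrite !mxE /= map_mpolyX.
    by rewrite /kk e det_map_mx rmorphXn.
  by rewrite mcoeff_map_mpoly realz.
have ge m : 0 <= (kk Q)@_m * (mfact m)%:R * (kk Q)@_m.
  by rewrite mulrAC mulr_ge0 // -expr2 real_exprn_even_ge0.
rewrite lt_def sumr_ge0 // andbT psumr_neq0 //.
have k0 : kk Q != 0 by rewrite expf_neq0 // det_varmx_neq0.
apply/hasP; exists (mlead (kk Q)); first exact: mlead_supp.
rewrite /= lt_def ge andbT !mulf_neq0 // ?mleadc_eq0 // pnatr_eq0 -lt0n.
by apply: prodn_gt0 => i; apply: fact_gt0.
Qed.

(** The invariant is [F q = apolar (kk Q) (hgen Q q)]. Acting on [q] by [g] substitutes [g *m X] for
    [X]; the adjunction moves this to [kk Q], which is unchanged. At [q = 0] only the constant term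
    of [Q] survives, and the value is that term times [apolar (kk Q) (kk Q)]. *)
Lemma invariant_of_relation (Q : {mpoly C[M]}) (p : TI -> C) : (0 < N)%N ->
  Q@_0%MM != 0 -> hgen Q p = 0 ->
  exists F : {mpoly C[M]},
  [/\ forall q g, \det g = 1 ->
        F.@[fun s => tact q g (enum_val s)] = F.@[fun s => q (enum_val s)],
      F.@[fun s => p (enum_val s)] = 0 & F.@[fun=> 0] != 0].
Proof.
move=> N0 Q0 Hp.
(* The tensor is made generic too: its coordinates become variables of the coefficient ring, so that
   [F] is a polynomial in them. *)
pose H : {mpoly {mpoly C[M]}[N * N]} :=
  homdet (@mpolyC (N * N) {mpoly C[M]} \o @mpolyC M C) Q (fun s => ('X_(enum_rank s))%:MP) (varmx N _).
pose F := \sum_(m <- msupp (kk Q)) ((kk Q)@_m * (mfact m)%:R) *: H@_m.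
have eH v : map_mpoly (meval v) H = hgen Q (v \o enum_rank).
  rewrite /H rmorph_homdet.
  have -> : map_mx (map_mpoly (meval v)) (varmx N {mpoly C[M]}) = X.
    by apply/matrixP => i j; rewrite !mxE /= map_mpolyX.
  apply: eq_homdet => [c|s] /=; first by rewrite map_mpolyC /= mevalC.
  by rewrite map_mpolyC /= mevalXU.
have FE v : F.@[v] = apolar (kk Q) (hgen Q (v \o enum_rank)).
  rewrite /F raddf_sum; apply: eq_bigr => m _ /=; rewrite mevalZ -eH.
  by rewrite mcoeff_map_mpoly.
have FE' q : F.@[fun s => q (enum_val s)] = apolar (kk Q) (hgen Q q).
  rewrite FE; apply: congr1; apply: eq_homdet => [c|s]; first by [].
  by rewrite /= enum_rankK.
exists F; split => [q g g1||].
- rewrite !FE'.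
  have -> : hgen Q (tact q g) = lsub (left_mulmx_mx g) (hgen Q q).
    rewrite /lsub rmorph_homdet -/(lsub _) lsub_varmx.
    transitivity (homdet (@mpolyC (N * N) C) Q (@mpolyC (N * N) C \o q) (map_mx (@mpolyC (N * N) C) g *m X)).
      apply: eq_homdet_tact => [|s]; first by rewrite det_mulmx det_map_mx g1 rmorph1 mul1r.
      by rewrite -tactM; apply: eq_tact => t; rewrite /= rmorph_tact.
    by apply: eq_homdet => [c|s] /=; rewrite comp_mpolyC.
  by rewrite apolar_lsub tr_left_mulmx_mx lsub_kk // det_tr.
- by rewrite FE' Hp apolar0r.
rewrite (FE' (fun=> 0)).
have -> : hgen Q (fun=> 0) = Q@_0%MM *: kk Q.
  have Q0s : 0%MM \in msupp Q by rewrite mcoeff_msupp.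
  rewrite /hgen /homdet (bigD1_seq 0%MM) ?msupp_uniq //= [X in _ + X]big1 ?addr0 => [|m nm].
    rewrite mdeg0 subn0 big1 ?mulr1 ?mul_mpolyC => // s _.
    by rewrite mnm0E muln0 expr0.
  have [i mi]: exists i, m i != 0%N.
    apply/existsP; apply: contraNT nm; rewrite negb_exists => /forallP h.
    by apply/eqP/mnmP => i; apply/eqP; rewrite mnm0E -[_ == _]negbK h.
  rewrite (bigD1 i) //= [tact _ _ _]big1 => [|s _]; last by rewrite /= mpolyC0 mul0r.
  by rewrite expr0n muln_eq0 (negbTE mi) orbF -leqn0 leqNgt N0 mul0r mulr0.
by rewrite apolarZr mulf_neq0 // gt_eqF // apolar_kk_gt0.
Qed.

End Reynolds.

(** * The Hilbert-Mumford theorem for tensors *)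

Section HilbertMumford.
Variables (C : numClosedFieldType) (N : nat) (J : finType).
Local Notation TI := {ffun J -> 'I_N}.
Local Notation M := #|{ffun J -> 'I_N}|.

Lemma homdet_mmap (K : fieldType) (iota : {rmorphism C -> K}) (Q : {mpoly C[M]})
    (q : TI -> K) (B : 'M[K]_N) : \det B != 0 ->
  homdet iota Q q B = \det B ^+ (#|J| * msize Q) *
    mmap iota (fun s => tact q B (enum_val s) ^+ N / \det B ^+ #|J|) Q.
Proof.
move=> detB; rewrite /mmap mulr_sumr; apply: eq_big_seq => m mQ.
have le : (mdeg m <= msize Q)%N := ltnW (msize_mdeg_lt mQ).
have -> : mmap1 (fun s => tact q B (enum_val s) ^+ N / \det B ^+ #|J|) m =
    (\prod_s tact q B (enum_val s) ^+ (N * m s)) / \det B ^+ (#|J| * mdeg m).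
  rewrite mdegE exprM -prodrXr -prodfV -big_split; apply: eq_bigr => s _ /=.
  by rewrite exprMn exprM exprVn.
rewrite -{2}(subnK le) mulnDr exprD; set E := \det B ^+ (_ * mdeg m).
have E0 : E != 0 by apply: expf_neq0.
by rewrite [RHS]mulrCA -(mulrA _ E) [E * _]mulrC divfK // mulrA.
Qed.

Section Valuation.
Variables (K : fieldType) (iota : {rmorphism C -> K}) (G : set (K * C)).
Hypothesis mG : maximal_place G.
Hypothesis iotaG : forall c, G (iota c, c).
Variables (p : TI -> C) (B : 'M[K]_N).
Hypothesis detB : \det B != 0.
Hypothesis G0 : forall s, G (tact (iota \o p) B s ^+ N / \det B ^+ #|J|, 0).
Let pG : partial_place G := mG.1.

Let count (t : TI) (i : 'I_N) : nat := #|[set l | t l == i]|.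

Lemma sum_count (V : zmodType) (f : 'I_N -> V) (t : TI) :
  \sum_l f (t l) = \sum_i f i *+ count t i.
Proof.
rewrite (partition_big t predT) //=; apply: eq_bigr => i _.
rewrite (eq_bigr (fun=> f i)) => [|l /eqP -> //].
by rewrite sumr_const /count cardsE.
Qed.

Lemma prod_count (f : 'I_N -> K) (t : TI) :
  \prod_l f (t l) = \prod_i f i ^+ count t i.
Proof.
rewrite (partition_big t predT) //=; apply: eq_bigr => i _.
rewrite (eq_bigr (fun=> f i)) => [|l /eqP -> //].
by rewrite prodr_const /count cardsE.
Qed.

Lemma valGL_reduce (L : 'M[K]_N) : valGL G L ->
  exists2 h : 'M[C]_N, h \in unitmx & forall i j, G (L i j, h i j).
Proof.
move=> [L' [LL' vL vL']].
have choose (A : 'M[K]_N) : valmx G A -> exists h : 'M[C]_N, forall i j, G (A i j, h i j).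
  move=> vA; have [f fP] := choice (fun ij : 'I_N * 'I_N => vA ij.1 ij.2).
  by exists (\matrix_(i, j) f (i, j)) => i j; rewrite mxE; apply: (fP (i, j)).
have [h hP] := choose _ vL; have [h' hP'] := choose _ vL'.
exists h => //; have : h *m h' = 1%:M; last by case/mulmx1_unit.
apply/matrixP => i j; apply: (place_fun pG (x := (L *m L') i j)).
  by rewrite !mxE; apply: (place_sum pG) => k _; apply: (placeM pG).
rewrite LL' !mxE; case: (i == j); [exact: (place1 pG) | exact: (place0 pG)].
Qed.

Lemma place_det (L : 'M[K]_N) (h : 'M[C]_N) :
  (forall i j, G (L i j, h i j)) -> G (\det L, \det h).
Proof.
move=> Lh; apply: (place_sum pG) => s _; apply: (placeM pG).
  apply: (placeX pG); have := placeB pG (place0 pG) (place1 pG).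
  by rewrite !sub0r.
by apply: (place_prod pG) => i _.
Qed.

Let field_id (D E L T U : K) : E != 0 -> L != 0 -> T != 0 -> U != 0 ->
  D / E = T * D / (L * E * U) * (T^-1 * (L * U)).
Proof. by move=> *; field; do !(apply/andP; split). Qed.

(** Write [B = L diag(d) U] and let [h] be the reduction of [L]. Where [p h] has a nonzero
    coordinate [t], that of [p L] is a unit; as [p L diag(d) = p B U^-1], the monomial [mon (cv t)]
    in the [d_i] is then sent to 0. Integral weights positive on all these exponents exist by
    [gordan]. *)
Lemma destabilizing_weights :
  exists2 h : 'M[C]_N, h \in unitmx &
  exists a : 'I_N -> int, \sum_i a i = 0 /\
    forall t, tact p h t != 0 -> 0 < \sum_l a (t l).
Proof.
have [L [d [U [vL [U' [UU' vU vU']] eB]]]] := val_smith mG B.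
have [h hu Lh] := valGL_reduce vL; exists h => //.
have GL := place_det Lh.
have dh0 : \det h != 0 by rewrite -unitfE -unitmxE.
have [|u uu Uu] := @valGL_reduce U; first by exists U'.
have du0 : \det u != 0 by rewrite -unitfE -unitmxE.
have GU := place_det Uu.
have detE : \det B = \det L * \prod_i d 0 i * \det U.
  by rewrite eB !det_mulmx det_diag.
move: (detB); rewrite detE !mulf_eq0 !negb_or => /andP[/andP[dL0 dd0] dU0].
have d0 i : d 0 i != 0 by move/prodf_neq0: dd0; apply.
(* Laurent monomials in the diagonal entries. [Pos c], that [mon c] is sent to 0, is stable under
   addition of exponents and fails for [c = 0]. *)
pose mon (c : 'rV[int]_N) : K := \prod_i d 0 i ^ c 0 i.
pose Pos c := G (mon c, 0).
(* The exponent of [(\prod_l d_(t l))^N / (\prod_i d_i)^#|J|]. *)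
pose cv (t : TI) : 'rV[int]_N := \row_i ((N * count t i)%N%:Z - #|J|%:Z).
have Pcv t : tact p h t != 0 -> Pos (cv t).
  move=> nz.
  have GT : G (tact (iota \o p) L t, tact p h t).
    apply: (place_sum pG) => s _; apply: (placeM pG); first exact: iotaG.
    by apply: (place_prod pG) => l _.
  have T0 : tact (iota \o p) L t != 0.
    apply: contra_neq nz => e; apply: (place_fun pG GT); rewrite e; exact: (place0 pG).
  (* [x] is a coordinate of [p B] of least valuation, so it divides every coordinate of
     [p B U^-1]. *)
  have [|x /mapP[s0 _ xE] xP] := @val_pivot _ _ _ mG [seq tact (iota \o p) B s | s <- enum {: TI}].
    by apply/eqP => e; have := mem_enum {: TI} t; case: (enum _) e.
  have [o [c Go] oE] : exists2 o, valring G o & tact (iota \o p) L t * \prod_l d 0 (t l) = o * x.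
    rewrite -tact_diag tactM (_ : L *m diag_mx d = B *m U'); last first.
      by rewrite eB -mulmxA UU' mulmx1.
    rewrite -tactM.
    have dv s : exists2 o, valring G o & tact (iota \o p) B s = o * x.
      by apply: xP; apply: map_f; rewrite mem_enum.
    have dv' s : exists o, valring G o /\ tact (iota \o p) B s = o * x.
      by have [o ? ?] := dv s; exists o.
    have [o oP] := choice dv'.
    exists (\sum_s o s * \prod_l U' (s l) (t l)).
      apply: (valring_sum mG) => s _; apply: (valringM mG); first by case: (oP s).
      by apply: (valring_prod mG) => l _.
    by rewrite mulr_suml; apply: eq_bigr => s _; rewrite (oP s).2 mulrAC.
  have monE : mon (cv t) = (o ^+ N * (x ^+ N / \det B ^+ #|J|)) *
      ((tact (iota \o p) L t)^-1 ^+ N * (\det L * \det U) ^+ #|J|).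
    have -> : mon (cv t) = (\prod_l d 0 (t l)) ^+ N / (\prod_i d 0 i) ^+ #|J|.
      rewrite (prod_count (fun i => d 0 i)) -!prodrXl -prodfV -big_split; apply: eq_bigr => i _ /=.
      by rewrite mxE expfzDr // -exprM mulnC exprnN.
    have e : o ^+ N * x ^+ N = tact (iota \o p) L t ^+ N * (\prod_l d 0 (t l)) ^+ N.
      by rewrite -!exprMn oE.
    rewrite detE !exprMn exprVn [o ^+ N * _]mulrA e.
    by apply: field_id; apply: expf_neq0.
  rewrite /Pos monE -(mul0r ((tact p h t)^-1 ^+ N * (\det h * \det u) ^+ #|J|)).
  rewrite -(mulr0 (c ^+ N)); apply: (placeM pG).
    by apply: (placeM pG); [apply: (placeX pG) | rewrite xE; apply: G0].
  apply: (placeM pG); apply: (placeX pG); first exact: placeV.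
  exact: (placeM pG).
have [|||a aP] := @gordan N Pos [seq cv t | t <- [seq t <- enum {: TI} | tact p h t != 0]].
- move=> c c'; rewrite /Pos -[X in G (mon (c + c'), X)](mulr0 0) => hc hc'.
  have -> : mon (c + c') = mon c * mon c'.
    by rewrite -big_split; apply: eq_bigr => i _; rewrite mxE expfzDr.
  exact: (placeM pG).
- rewrite /Pos /mon big1 => [h1|i _]; last by rewrite mxE expr0z.
  by have /eqP := place_fun pG (place1 pG) h1; rewrite oner_eq0.
- by move=> c /mapP[t]; rewrite mem_filter => /andP[nz _] ->; apply: Pcv.
(* Recentring gives weights of sum 0; their total over the factors of [t] is the pairing of [cv t]
   with [a]. *)
pose S := \sum_i a i 0; exists (fun i => a i 0 * N%:Z - S); split=> [|t nz].
  by rewrite sumrB -mulr_suml sumr_const card_ord -/S -mulr_natr natz subrr.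
rewrite sumrB sumr_const -mulr_suml (sum_count (fun i => a i 0)).
have := aP (cv t); rewrite map_f; last by rewrite mem_filter nz mem_enum.
move=> /(_ isT).
rewrite mxE (eq_bigr (fun i => a i 0 *+ count t i * N%:Z - a i 0 * #|J|%:Z)) => [|i _]; last first.
  by rewrite mxE PoszM -mulr_natr natz; ring.
by rewrite sumrB -!mulr_suml -/S -[S *+ _]mulr_natr natz.
Qed.

End Valuation.

(** Semistability of [p] takes the form of an invariant polynomial, possibly inhomogeneous, that
    separates [p] from 0. *)
Theorem hilbert_mumford (p : TI -> C) : (0 < N)%N ->
  (forall (h : 'M[C]_N) (a : 'I_N -> int), h \in unitmx -> \sum_i a i = 0 ->
     exists2 s, tact p h s != 0 & \sum_l a (s l) <= 0) ->
  exists F : {mpoly C[M]},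
  [/\ forall q g, \det g = 1 ->
        F.@[fun s => tact q g (enum_val s)] = F.@[fun s => q (enum_val s)],
      F.@[fun s => p (enum_val s)] = 0 & F.@[fun=> 0] != 0].
Proof.
move=> N0 ss.
have [[Q [Q0 HQ]]|noQ] := pselect (exists Q : {mpoly C[M]}, Q@_0%MM != 0 /\
   homdet (@mpolyC (N * N) C) Q (@mpolyC (N * N) C \o p) (varmx N C) = 0).
  exact: (invariant_of_relation N0 Q0 HQ).
pose iota : {rmorphism C -> {fraction {mpoly C[N * N]}}} :=
  (@FracField.tofrac {mpoly C[N * N]} : {rmorphism _ -> _}) \o (@mpolyC (N * N) C).
pose B : 'M_N := map_mx (@FracField.tofrac {mpoly C[N * N]}) (varmx N C).
have detB : \det B != 0 by rewrite det_map_mx tofrac_eq0 det_varmx_neq0.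
pose f s := tact (iota \o p) B s ^+ N / \det B ^+ #|J|.
pose ev (Q : {mpoly C[M]}) := mmap iota (f \o enum_val) Q.
have ev_homdet Q : \det B ^+ (#|J| * msize Q) * ev Q = homdet iota Q (iota \o p) B.
  by rewrite homdet_mmap.
(* The graph of [Q(f) |-> Q(0)]; it is single-valued because no relation among the [f s] has a
   nonzero constant term. *)
pose G0 : set ({fraction {mpoly C[N * N]}} * C) := [set xc | exists Q, xc = (ev Q, Q@_0%MM)]%classic.
have pG0 : partial_place G0.
  split.
  - by exists 1; rewrite /ev rmorph1 mcoeff1 eqxx.
  - by move=> _ _ _ _ [Q [-> ->]] [Q' [-> ->]]; exists (Q - Q'); rewrite /ev rmorphB mcoeffB.
  - move=> _ _ _ _ [Q [-> ->]] [Q' [-> ->]]; exists (Q * Q').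
    have e1 : ev (Q * Q') = ev Q * ev Q' by rewrite /ev rmorphM.
    have e2 : (Q * Q')@_0%MM = Q@_0%MM * Q'@_0%MM by rewrite rmorphM.
    by rewrite e1 e2.
  - by move=> c; exists (iota c), c%:MP; rewrite /ev mmapC mcoeffC eqxx mulr1.
  - move=> c [Q [/esym evQ ->]]; apply/eqP; apply: contra_notT noQ => Q0.
    exists Q; split=> //; apply/eqP; rewrite -tofrac_eq0 rmorph_homdet.
    by rewrite -ev_homdet evQ mulr0.
have [G mG sG] := maximal_place_exists pG0.
have iotaG c : G (iota c, c).
  by apply: sG; exists c%:MP; rewrite /ev mmapC mcoeffC eqxx mulr1.
have fG s : G (f s, 0).
  apply: sG; exists 'X_(enum_rank s).
  by rewrite /ev mmapX mmap1U /= enum_rankK mcoeffX mnm1_eq0.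
have [h hu [a [a0 aP]]] := destabilizing_weights mG iotaG detB fG.
have [s nz] := ss h a hu a0.
by rewrite leNgt aP.
Qed.

End HilbertMumford.

(** * Derivations and valuations of the function field *)

Lemma mpoly_rmorph_ext (A S : comNzRingType) n (f g : {rmorphism {mpoly A[n]} -> S}) :
  (forall c, f c%:MP = g c%:MP) -> (forall i, f 'X_i = g 'X_i) -> f =1 g.
Proof.
move=> fgC fgX p; rewrite [p]mpolyE !rmorph_sum; apply: eq_bigr => m _ /=.
rewrite -mul_mpolyC !rmorphM fgC mpolyXE_id !rmorph_prod; congr (_ * _).
by apply: eq_bigr => i _; rewrite !rmorphXn fgX.
Qed.

Lemma fraction_repr (D : idomainType) (x : {fraction D}) :
  x * FracField.tofrac \d_(repr x) = FracField.tofrac \n_(repr x).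
Proof.
move: (repr x) (reprK x) => r <-; unlock FracField.tofrac.
rewrite -[LHS]FracField.pi_mul; apply/eqmodP.
rewrite /= FracField.equivfE /FracField.mulf !numden_Ratio ?oner_neq0 ?mulr1 ?denom_ratioP //.
by rewrite mulrC.
Qed.

Lemma frac_cross (F : fieldType) (p q a d : F) : q != 0 -> d != 0 ->
  p / q = a / d -> a * q = p * d.
Proof. by move=> q0 d0 /eqP; rewrite eqr_div // => /eqP ->. Qed.

(** Primed letters stand for derivatives: the quotient rule gives the same value for the fractions
    [a / d] and [p / q], by [a q = p d] and its derivative. *)
Lemma wronskian_unique (F : fieldType) (p p' q q' a a' d d' : F) : q != 0 -> d != 0 ->
  a * q = p * d -> a' * q + a * q' = p' * d + p * d' ->
  (a' * d - a * d') / d ^+ 2 = (p' * q - p * q') / q ^+ 2.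
Proof.
move=> q0 d0 e0 e1; apply/eqP; rewrite eqr_div ?expf_neq0 // -subr_eq0; apply/eqP.
transitivity (d * q * ((a' * q + a * q') - (p' * d + p * d')) -
  (a * q - p * d) * (d' * q + d * q')); first by ring.
by rewrite e0 e1 !subrr mulr0 mul0r subr0.
Qed.

Lemma quotient_rule (F : fieldType) (p p' q q' r r' s s' : F) : q != 0 -> s != 0 ->
  ((p' * r + p * r') * (q * s) - p * r * (q' * s + q * s')) / (q * s) ^+ 2 =
  (p' * q - p * q') / q ^+ 2 * (r / s) + p / q * ((r' * s - r * s') / s ^+ 2).
Proof. by move=> q0 s0; field; apply/andP. Qed.

Lemma log_derivativeM (F : fieldType) (x y x' y' : F) : x != 0 -> y != 0 ->
  (x' * y + x * y') / (x * y) = x' / x + y' / y.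
Proof. by move=> x0 y0; field; apply/andP. Qed.

Section FunctionField.
Variables (C : fieldType) (n : nat).
Local Notation F := {fraction {mpoly C[n]}}.
Implicit Types (p q : {mpoly C[n]}) (x y : F).

Definition rfun p : F := FracField.tofrac p.

(* [fderiv] over an arbitrary field of constants; the two are convertible over [R[i]]. *)
Definition rderiv (j : 'I_n) (x : F) : F :=
  let p := \n_(repr x) in let q := \d_(repr x) in
  rfun (p^`M(j) * q - p * q^`M(j)) / rfun q ^+ 2.

Lemma rfun_eq0 p : (rfun p == 0) = (p == 0).
Proof. exact: tofrac_eq0. Qed.

Lemma funfield_repr x : rfun \d_(repr x) != 0 /\
  x = rfun \n_(repr x) / rfun \d_(repr x).
Proof.
have d0 : rfun \d_(repr x) != 0 by rewrite rfun_eq0 denom_ratioP.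
split=> //; apply: (mulIf d0); rewrite divfK //.
by rewrite fraction_repr.
Qed.

Lemma funfieldP x : exists p q, [/\ p != 0 \/ x = 0, q != 0 & x = rfun p / rfun q].
Proof.
have [d0 xE] := funfield_repr x; exists \n_(repr x), \d_(repr x); split=> //.
  have [n0|] := eqVneq \n_(repr x) 0; [right | by left].
  by rewrite xE n0 /rfun tofrac0 mul0r.
by rewrite -rfun_eq0.
Qed.

Lemma rfunM p q : rfun (p * q) = rfun p * rfun q.
Proof. exact: tofracM. Qed.
Lemma rfunB p q : rfun (p - q) = rfun p - rfun q.
Proof. exact: tofracB. Qed.
Lemma rfunD p q : rfun (p + q) = rfun p + rfun q.
Proof. exact: tofracD. Qed.
Lemma rfun1 : rfun (1 : {mpoly C[n]}) = 1.
Proof. exact: tofrac1. Qed.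
Lemma rfun_inj : injective (@rfun).
Proof. by move=> p q /eqP; rewrite tofrac_eq => /eqP. Qed.

Lemma rfun_wronskian j p q : rfun (p^`M(j) * q - p * q^`M(j)) =
  rfun p^`M(j) * rfun q - rfun p * rfun q^`M(j).
Proof. by rewrite rfunB (rfunM p^`M(j) q) (rfunM p q^`M(j)). Qed.

Lemma rderiv_frac j p q : q != 0 ->
  rderiv j (rfun p / rfun q) =
  (rfun p^`M(j) * rfun q - rfun p * rfun q^`M(j)) / rfun q ^+ 2.
Proof.
rewrite -rfun_eq0 => q0; have [d0 xE] := funfield_repr (rfun p / rfun q).
rewrite /rderiv rfun_wronskian; move: d0 xE.
move: (\n_(repr (rfun p / rfun q))) (\d_(repr (rfun p / rfun q))) => a d d0 xE.
have e0 := frac_cross q0 d0 xE.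
have e1 : rfun a^`M(j) * rfun q + rfun a * rfun q^`M(j) =
          rfun p^`M(j) * rfun d + rfun p * rfun d^`M(j).
  have e : a * q = p * d.
    by apply: rfun_inj; rewrite (rfunM a q) (rfunM p d).
  have := congr1 (@rfun \o mderiv j) e; rewrite /= (mderivM j a q) (mderivM j p d).
  rewrite (rfunD (_ * q)) (rfunD (_ * d)).
  by rewrite (rfunM _ q) (rfunM a) (rfunM _ d) (rfunM p).
exact: (wronskian_unique q0 d0 e0 e1).
Qed.

Lemma rderiv_rfun j p : rderiv j (rfun p) = rfun p^`M(j).
Proof.
have := @rderiv_frac j p 1 (oner_neq0 _).
by rewrite rfun1 invr1 mulr1 expr1n invr1 !mulr1 -mpolyC1 mderivC mulr0 subr0.
Qed.

Lemma rderivM j x y : rderiv j (x * y) = rderiv j x * y + x * rderiv j y.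
Proof.
have [p [q [_ q0 ->]]] := funfieldP x; have [p' [q' [_ q0' ->]]] := funfieldP y.
have qq0 : q * q' != 0 by apply: mulf_neq0.
rewrite mulf_div -(rfunM p) -(rfunM q) (rderiv_frac j _ qq0).
rewrite (rderiv_frac j _ q0) (rderiv_frac j _ q0') (mderivM j p) (mderivM j q).
rewrite (rfunD (_ * p')) (rfunD (_ * q')) (rfunM p^`M(j) p') (rfunM p p'^`M(j)).
rewrite (rfunM p p') (rfunM q^`M(j) q') (rfunM q q'^`M(j)) (rfunM q q').
by apply: quotient_rule; rewrite rfun_eq0.
Qed.

(** Logarithmic derivatives are additive on Laurent monomials, which makes the Jacobian of monomial
    coordinates computable. *)
Definition dlog j x := rderiv j x / x.

Lemma dlog1 j : dlog j 1 = 0.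
Proof. by rewrite /dlog -rfun1 rderiv_rfun -mpolyC1 mderivC /rfun tofrac0 mul0r. Qed.

Lemma dlogM j x y : x != 0 -> y != 0 -> dlog j (x * y) = dlog j x + dlog j y.
Proof.
by move=> x0 y0; rewrite /dlog rderivM; exact: (log_derivativeM _ _ x0 y0).
Qed.

Lemma dlogV j x : x != 0 -> dlog j x^-1 = - dlog j x.
Proof.
move=> x0; apply/eqP; rewrite -addr_eq0 addrC -dlogM ?invr_eq0 // mulfV //.
by rewrite dlog1.
Qed.

Lemma dlogX j x e : x != 0 -> dlog j (x ^+ e) = dlog j x *+ e.
Proof.
move=> x0; elim: e => [|e IH]; first by rewrite expr0 dlog1.
by rewrite exprS dlogM ?expf_neq0 // IH mulrS.
Qed.

Lemma dlogXz j x (e : int) : x != 0 -> dlog j (x ^ e) = dlog j x *~ e.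
Proof.
move=> x0; case: e => e; first exact: dlogX.
by rewrite NegzE -exprnN dlogV ?expf_neq0 // dlogX // mulrNz.
Qed.

Lemma dlog_prod (I : finType) j (f : I -> F) :
  (forall i, f i != 0) -> dlog j (\prod_i f i) = \sum_i dlog j (f i).
Proof.
move=> f0; suff : \prod_i f i != 0 /\ dlog j (\prod_i f i) = \sum_i dlog j (f i) by case.
elim/big_rec2: _ => [|i y x _ [y0 IH]]; first by split; [exact: oner_neq0 | exact: dlog1].
split; first exact: (mulf_neq0 (f0 i) y0).
rewrite (dlogM j (f0 i) y0).
by rewrite IH.
Qed.

End FunctionField.

(** * Formal properties of valuations *)

Section ValuationTheory.
Variables (F : fieldType) (v : F -> int).
Hypothesis valM : forall x y, x != 0 -> y != 0 -> v (x * y) = v x + v y.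
Hypothesis valD : forall x y, x != 0 -> y != 0 -> x + y != 0 ->
  Num.min (v x) (v y) <= v (x + y).

Lemma val1 : v 1 = 0.
Proof. by have := valM (oner_neq0 _) (oner_neq0 _); rewrite mulr1 => /eqP; rewrite -subr_eq0 opprD addNKr oppr_eq0 => /eqP. Qed.

Lemma valV x : x != 0 -> v x^-1 = - v x.
Proof.
by move=> x0; apply/eqP; rewrite -addr_eq0 -valM ?invr_eq0 // mulVf // val1.
Qed.

Lemma valX x e : x != 0 -> v (x ^+ e) = v x *+ e.
Proof.
move=> x0; elim: e => [|e IH]; first by rewrite expr0 val1.
by rewrite exprS valM ?expf_neq0 // IH mulrS.
Qed.

Lemma valXz x (e : int) : x != 0 -> v (x ^ e) = v x * e.
Proof.
move=> x0; case: e => e; first by rewrite -exprnP valX // -mulr_natr natz.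
by rewrite NegzE -exprnN valV ?expf_neq0 // valX // -[v x *+ _]mulr_natr natz mulrN.
Qed.

Lemma val_prod (I : finType) (f : I -> F) :
  (forall i, f i != 0) -> v (\prod_i f i) = \sum_i v (f i).
Proof.
move=> f0; suff : \prod_i f i != 0 /\ v (\prod_i f i) = \sum_i v (f i) by case.
elim/big_rec2: _ => [|i y x _ [y0 IH]]; first by rewrite oner_neq0 val1.
by rewrite mulf_neq0 // valM // IH.
Qed.

Lemma val_sum_ge (I : eqType) (r : seq I) (f : I -> F) (e : int) :
  (forall i, i \in r -> f i != 0 -> e <= v (f i)) ->
  \sum_(i <- r) f i != 0 -> e <= v (\sum_(i <- r) f i).
Proof.
elim: r => [|i r IH] h; first by rewrite big_nil eqxx.
have {}IH := IH (fun j jr => h j (@mem_behead _ (i :: r) j jr)).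
rewrite big_cons; have [->|s0] := eqVneq (\sum_(j <- r) f j) 0.
  by rewrite addr0; apply: h; rewrite mem_head.
have [->|f0] := eqVneq (f i) 0; first by rewrite add0r => _; apply: IH.
move=> fs; apply: le_trans (valD f0 s0 fs).
by rewrite le_min h ?mem_head //= IH.
Qed.

End ValuationTheory.

(** * Monomial valuations *)

Section ToricValuation.
Variables (C : numFieldType) (n : nat) (u z : n.-tuple {mpoly C[n]}).
Hypothesis uz : forall q, tnth u q \mPo z = 'X_q.
Hypothesis zu : forall l, tnth z l \mPo u = 'X_l.
Variables (b : 'I_n -> nat) (E : int).
Local Notation F := {fraction {mpoly C[n]}}.
Implicit Types (p q : {mpoly C[n]}) (x y : F).

Lemma comp_zu p : (p \mPo z) \mPo u = p.
Proof.
apply: (mpoly_rmorph_ext (f := comp_mpoly u \o comp_mpoly z) (g := idfun)) => [c|i] /=.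
  by rewrite !comp_mpolyC.
by rewrite comp_mpolyXU -tnth_nth zu.
Qed.

Lemma comp_uz p : (p \mPo u) \mPo z = p.
Proof.
apply: (mpoly_rmorph_ext (f := comp_mpoly z \o comp_mpoly u) (g := idfun)) => [c|i] /=.
  by rewrite !comp_mpolyC.
by rewrite comp_mpolyXU -tnth_nth uz.
Qed.

(* [p] evaluated at the point [(T ^ b_0 z_0, ..., T ^ b_(n-1) z_(n-1))]. *)
Definition torus_curve : {mpoly C[n]} -> {poly F} :=
  mmap ((@polyC F \o @FracField.tofrac {mpoly C[n]}) \o @mpolyC n C)
       (fun i => (rfun 'X_i)%:P * 'X^(b i)).

(** At [T = 1] the curve passes through the generic point, so no nonzero polynomial vanishes along
    it. *)
Lemma torus_curve1 p : (torus_curve p).[1] = rfun p.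
Proof.
pose f : {rmorphism {mpoly C[n]} -> F} := horner_eval 1 \o torus_curve.
apply: (mpoly_rmorph_ext (f := f) (g := @FracField.tofrac {mpoly C[n]})) => [c|i].
  by rewrite /f /= /torus_curve mmapC /horner_eval hornerC.
rewrite /f /= /torus_curve mmapX mmap1U /horner_eval hornerM hornerC hornerXn.
by rewrite expr1n mulr1.
Qed.

Lemma torus_curve_neq0 p : p != 0 -> torus_curve p != 0.
Proof.
by apply: contra_neq => t0; apply/eqP; rewrite -rfun_eq0 -torus_curve1 t0 horner0.
Qed.

(** [p \mPo z] is [p] written in the coordinates [u]; for [p != 0] the order at [T = 0] is the least
    [b]-weight of a monomial of that expression. *)
Definition curve_order p : nat := mup 0 (torus_curve (p \mPo z)).

Let comp_neq0 p : p != 0 -> torus_curve (p \mPo z) != 0.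
Proof.
move=> p0; apply: torus_curve_neq0; apply: contra_neq p0 => e.
by rewrite -[p]comp_zu e comp_mpoly0.
Qed.

Lemma curve_orderM p q : p != 0 -> q != 0 ->
  curve_order (p * q) = (curve_order p + curve_order q)%N.
Proof.
move=> p0 q0; rewrite /curve_order rmorphM /= /torus_curve rmorphM.
exact: (mupM _ (comp_neq0 p0) (comp_neq0 q0)).
Qed.

Lemma curve_orderD p q : p != 0 -> q != 0 -> p + q != 0 ->
  (minn (curve_order p) (curve_order q) <= curve_order (p + q))%N.
Proof.
move=> p0 q0 pq0; rewrite /curve_order (mup_geq _ _ (comp_neq0 pq0)).
rewrite rmorphD /= /torus_curve rmorphD -!/(torus_curve _).
apply: dvdp_add; rewrite -mup_geq ?comp_neq0 //; [exact: geq_minl | exact: geq_minr].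
Qed.

Lemma curve_orderC (c : C) : c != 0 -> curve_order c%:MP = 0%N.
Proof.
move=> c0; rewrite /curve_order comp_mpolyC /torus_curve mmapC mupNroot //=.
by rewrite rootC tofrac_eq0 mpolyC_eq0.
Qed.

Lemma torus_curve_homog p e :
  (forall m, m \in msupp p -> (\sum_i b i * m i)%N = e) ->
  torus_curve p = (rfun p)%:P * 'X^e.
Proof.
move=> h; rewrite [p in RHS]mpolyE /torus_curve /mmap /rfun rmorph_sum rmorph_sum mulr_suml.
apply: eq_big_seq => m /h <-; rewrite -mul_mpolyC rmorphM rmorphM -mulrA; congr (_ * _).
rewrite /mmap1 mpolyXE_id rmorph_prod rmorph_prod -prodrXr -big_split.
by apply: eq_bigr => q _ /=; rewrite exprMn -exprM rmorphXn rmorphXn.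
Qed.

Lemma curve_order_homog p e : p != 0 ->
  (forall m, m \in msupp p -> (\sum_i b i * m i)%N = e) ->
  curve_order (p \mPo u) = e.
Proof.
move=> p0 h; rewrite /curve_order comp_uz (torus_curve_homog h).
have c0 : (rfun p)%:P != 0 :> {poly F} by rewrite polyC_eq0 rfun_eq0.
have X0 : 'X^e != 0 :> {poly F} by rewrite expf_neq0 // polyX_eq0.
rewrite (mupM _ c0 X0) mupNroot; last by rewrite rootC rfun_eq0.
by have := mup_XsubCX e (0 : F) 0; rewrite subr0 eqxx.
Qed.

Lemma curve_order_coord (q : 'I_n) : curve_order (tnth u q) = b q.
Proof.
have -> : tnth u q = 'X_q \mPo u by rewrite comp_mpolyXU -tnth_nth.
apply: curve_order_homog => [|m]; first by rewrite -msupp_eq0 msuppX.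
rewrite msuppX inE => /eqP ->; rewrite (bigD1 q) //= mnm1E eqxx muln1 big1 ?addn0 // => i ni.
by rewrite mnm1E eq_sym (negbTE ni) muln0.
Qed.

(* A valuation is unconstrained at 0; taking [E] large there spares proving that
   a form does not vanish identically on a chart. *)
Definition toric_val x : int :=
  if x == 0 then E else (curve_order \n_(repr x))%:Z - (curve_order \d_(repr x))%:Z.

Lemma toric_val_frac p q : p != 0 -> q != 0 ->
  toric_val (rfun p / rfun q) = (curve_order p)%:Z - (curve_order q)%:Z.
Proof.
move=> p0 q0; have q0' : rfun q != 0 by rewrite rfun_eq0.
have x0 : rfun p / rfun q != 0.
  by apply: mulf_neq0; [rewrite rfun_eq0 | rewrite invr_eq0].
rewrite /toric_val (negbTE x0); have [d0 xE] := funfield_repr (rfun p / rfun q).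
move: x0 d0 xE.
move: (\n_(repr (rfun p / rfun q))) (\d_(repr (rfun p / rfun q))) => a d x0 d0 xE.
have e0 := frac_cross q0' d0 xE.
have e : a * q = p * d.
  by apply: rfun_inj; rewrite (rfunM a q) (rfunM p d).
have d1 : d != 0 by rewrite -rfun_eq0.
have a1 : a != 0.
  by apply: contra_neq x0 => a0; rewrite xE a0 /rfun tofrac0 mul0r.
have := congr1 curve_order e; rewrite (curve_orderM a1 q0) (curve_orderM p0 d1).
by lia.
Qed.

Lemma toric_val0 : toric_val 0 = E.
Proof. by rewrite /toric_val eqxx. Qed.

Lemma toric_val_rfun p : p != 0 -> toric_val (rfun p) = curve_order p.
Proof.
move=> p0; have := toric_val_frac p0 (oner_neq0 _).
rewrite rfun1 invr1 mulr1 => ->.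
by rewrite -mpolyC1 curve_orderC ?oner_neq0 // subr0.
Qed.

Let repr_neq0 x : x != 0 -> exists p q, [/\ p != 0, q != 0 & x = rfun p / rfun q].
Proof.
move=> x0; have [p [q [[p0|e] q0 xE]]] := funfieldP x; first by exists p, q.
by move: x0; rewrite e eqxx.
Qed.

Lemma toric_valM x y : x != 0 -> y != 0 -> toric_val (x * y) = toric_val x + toric_val y.
Proof.
move=> /repr_neq0[p [q [p0 q0 ->]]] /repr_neq0[p' [q' [p0' q0' ->]]].
rewrite mulf_div -(rfunM p p') -(rfunM q q').
rewrite (toric_val_frac (mulf_neq0 p0 p0') (mulf_neq0 q0 q0')).
rewrite (toric_val_frac p0 q0) (toric_val_frac p0' q0').
rewrite (curve_orderM p0 p0') (curve_orderM q0 q0').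
by lia.
Qed.

Lemma toric_valD x y : x != 0 -> y != 0 -> x + y != 0 ->
  Num.min (toric_val x) (toric_val y) <= toric_val (x + y).
Proof.
move=> /repr_neq0[p [q [p0 q0 ->]]] /repr_neq0[p' [q' [p0' q0' ->]]].
have q1 : rfun q != 0 by rewrite rfun_eq0.
have q1' : rfun q' != 0 by rewrite rfun_eq0.
rewrite (addf_div _ _ q1 q1') -(rfunM p q') -(rfunM p' q) -(rfunM q q') -rfunD => xy0.
have s0 : p * q' + p' * q != 0.
  by apply: contra_neq xy0 => ->; rewrite /rfun tofrac0 mul0r.
rewrite (toric_val_frac s0 (mulf_neq0 q0 q0')).
rewrite (toric_val_frac p0 q0) (toric_val_frac p0' q0').
have := curve_orderD (mulf_neq0 p0 q0') (mulf_neq0 p0' q0) s0.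
rewrite (curve_orderM p0 q0') (curve_orderM p0' q0) (curve_orderM q0 q0').
have key (k l l' s : nat) : (k + l' <= s)%N -> k%:Z - l%:Z <= s%:Z - (l + l')%N%:Z by lia.
rewrite geq_min ge_min => /orP[h|h]; apply/orP; [left | right]; first exact: key.
by rewrite (addnC (curve_order q)); exact: key.
Qed.

Lemma toric_val_ge0 p : p != 0 -> 0 <= toric_val (rfun p).
Proof. by move=> p0; rewrite toric_val_rfun. Qed.

Lemma toric_val_C (c : C) : c != 0 -> toric_val (rfun c%:MP) = 0.
Proof. by move=> c0; rewrite toric_val_rfun ?mpolyC_eq0 // curve_orderC. Qed.

End ToricValuation.

Section ToricDivisor.
Variables (C : numFieldType) (n : nat) (u z : n.-tuple {mpoly C[n]}).
Hypothesis uz : forall i, tnth u i \mPo z = 'X_i.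
Hypothesis zu : forall l, tnth z l \mPo u = 'X_l.
Variables (b : 'I_n -> nat) (E : int) (c : 'I_n -> int) (i0 : 'I_n).
Hypothesis bezout : \sum_i c i * (b i)%:Z = 1.
Hypothesis b0_gt0 : (0 < b i0)%N.
Local Notation F := {fraction {mpoly C[n]}}.
Local Notation v := (toric_val z b E).

Let vM x y : x != 0 -> y != 0 -> v (x * y) = v x + v y.
Proof. exact: (toric_valM zu). Qed.

Let U i : F := rfun (tnth u i).

Let tnth_neq0 i : tnth u i != 0.
Proof.
apply/eqP => u0; have := uz i; rewrite u0 comp_mpoly0 => /esym/eqP.
by rewrite -msupp_eq0 msuppX.
Qed.

Let U0 i : U i != 0. Proof. by rewrite rfun_eq0. Qed.

Let vU i : v (U i) = b i.
Proof. by rewrite (toric_val_rfun zu) // (curve_order_coord uz). Qed.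

(* The rows other than [i0] span, over the rationals, the exponents of weight 0. *)
Definition toric_exponent (i q : 'I_n) : int :=
  if i == i0 then c q else (b i0)%:Z *+ (q == i) - (b i)%:Z *+ (q == i0).

(** [y i0] is the monomial [u^c], of value 1 by the Bezout relation; the other [y i] are
    [u_i^(b i0) / u_i0^(b i)], of value 0. *)
Definition toric_coord (i : 'I_n) : F := \prod_q U q ^ toric_exponent i q.
Local Notation y := toric_coord.

Let UX0 i (e : int) : U i ^ e != 0. Proof. by rewrite expfz_neq0. Qed.

Lemma toric_coord_neq0 i : y i != 0.
Proof. by apply/prodf_neq0 => q _. Qed.

Lemma toric_val_coord i : v (y i) = (i == i0)%:Z.
Proof.
rewrite /toric_coord (val_prod vM (fun q => UX0 q _)).
rewrite (eq_bigr (fun q => (b q)%:Z * toric_exponent i q)) => [|q _]; last first.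
  by rewrite (valXz vM _ (U0 q)) vU.
rewrite /toric_exponent; case: eqP => [_|/eqP ni].
  transitivity (\sum_i c i * (b i)%:Z); last exact: bezout.
  by apply: eq_bigr => q _; rewrite mulrC.
rewrite (bigD1 i0) //= (bigD1 i) //= big1 => [|q /andP[/negbTE -> /negbTE ->]]; last first.
  by rewrite !mulr0n subr0 mulr0.
by rewrite !eqxx (negbTE ni) eq_sym (negbTE ni) !mulr0n !mulr1n; ring.
Qed.

Lemma toric_coord_lift l :
  y (lift i0 l) = U (lift i0 l) ^+ b i0 / U i0 ^+ b (lift i0 l).
Proof.
have nl : lift i0 l != i0 by rewrite eq_sym neq_lift.
rewrite /toric_coord (bigD1 i0) //= (bigD1 (lift i0 l)) //= big1 => [|q]; last first.
  by case/andP=> /negbTE q0 /negbTE ql; rewrite /toric_exponent (negbTE nl) q0 ql.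
rewrite /toric_exponent (negbTE nl) (negbTE (neq_lift _ _)) !eqxx.
by rewrite !mulr0n !mulr1n sub0r subr0 mulr1 -exprnN -exprnP mulrC.
Qed.

Section AlgebraicIndependence.
Variable g : {mpoly C[n.-1]}.
Hypothesis g0 : g != 0.

(** A power of [U i0] large enough to clear the denominators of [g(y)]. The result is [G] in the
    coordinates [u]: distinct monomials of [g] go to distinct monomials, all of weight
    [b i0 * e0]. *)
Let e0 := (\sum_l b (lift i0 l) * msize g)%N.
Let wt (m : 'X_{1..n.-1}) := (\sum_l b (lift i0 l) * m l)%N.
Let expo (m : 'X_{1..n.-1}) : 'X_{1..n} :=
  [multinom if unlift i0 q is Some l then b i0 * m l else e0 - wt m | q < n]%N.
Let G : {mpoly C[n]} := \sum_(m <- msupp g) g@_m *: 'X_[expo m].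
Let gy : F := mmap (fun a : C => rfun a%:MP) (fun l => y (lift i0 l)) g.

Let expo_lift m l : expo m (lift i0 l) = (b i0 * m l)%N.
Proof. by rewrite mnmE liftK. Qed.

Let expo0 m : expo m i0 = (e0 - wt m)%N.
Proof. by rewrite mnmE unlift_none. Qed.

Let wt_le m : m \in msupp g -> (wt m <= e0)%N.
Proof.
move=> /msize_mdeg_lt lt; apply: leq_sum => l _; rewrite leq_mul2l; apply/orP; right.
by apply: leq_trans (ltnW lt); rewrite mdegE (bigD1 l) //= leq_addr.
Qed.

Let expo_inj : injective expo.
Proof.
move=> m m' e; apply/mnmP => l; have := congr1 (fun k : 'X_{1..n} => k (lift i0 l)) e.
by rewrite !expo_lift => /eqP; rewrite eqn_pmul2l // => /eqP.
Qed.

Let G_coef k : G@_k = \sum_(m <- msupp g) g@_m * (expo m == k)%:R.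
Proof.
rewrite raddf_sum; apply: eq_bigr => m _ /=; by rewrite mcoeffZ mcoeffX.
Qed.

Let G0 : G != 0.
Proof.
have m0 : mlead g \in msupp g by apply: mlead_supp.
apply/eqP => /(congr1 (mcoeff (expo (mlead g)))); rewrite mcoeff0 G_coef.
rewrite (bigD1_seq (mlead g)) ?msupp_uniq //= eqxx mulr1 big1 ?addr0 => [/eqP|m nm].
  by rewrite mleadc_eq0 (negbTE g0).
by rewrite (inj_eq expo_inj) (negbTE nm) mulr0.
Qed.

Let G_homog m : m \in msupp G -> (\sum_i b i * m i)%N = (b i0 * e0)%N.
Proof.
rewrite mcoeff_msupp G_coef => nz.
have [k kg <-] : exists2 k, k \in msupp g & expo k = m.
  apply: contrapT => no; move/eqP: nz; apply; rewrite big1_seq // => k /andP[_ kg].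
  by case: eqP => [e|]; [case: no; exists k | rewrite mulr0].
rewrite (bigD1_ord i0) //= expo0 (eq_bigr (fun l => b i0 * (b (lift i0 l) * k l)))%N => [|l _].
  by rewrite -big_distrr /= -mulnDr subnK // wt_le.
by rewrite expo_lift mulnCA.
Qed.

Let rfun_comp_X (k : 'X_{1..n}) : rfun ('X_[k] \mPo u) = \prod_i U i ^+ k i.
Proof.
rewrite comp_mpolyX /rfun rmorph_prod; apply: eq_bigr => i _.
by rewrite rmorphXn.
Qed.

Let gyE : gy * U i0 ^+ e0 = rfun (G \mPo u).
Proof.
rewrite /gy /mmap /G [_ \mPo u]raddf_sum /rfun [RHS]raddf_sum mulr_suml.
apply: eq_big_seq => m mg /=; rewrite comp_mpolyZ -mul_mpolyC rmorphM -mulrA.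
congr (_ * _); rewrite -[RHS]/(rfun ('X_[expo m] \mPo u)) rfun_comp_X (bigD1_ord i0) //= expo0 /mmap1.
rewrite (eq_bigr (fun l => U (lift i0 l) ^+ expo m (lift i0 l) *
   (U i0)^-1 ^+ (b (lift i0 l) * m l))) => [|l _]; last first.
  by rewrite toric_coord_lift exprMn expo_lift !exprVn -!exprM.
rewrite big_split /= prodrXr -/(wt m) -mulrA mulrC; congr (_ * _).
by rewrite exprVn -{1}(subnK (wt_le mg)) exprD mulrC mulfK // expf_neq0.
Qed.

(** In [g(y) * U i0 ^+ e0 = G(u)] both [U i0 ^+ e0] and [G(u)] have value [b i0 * e0]. *)
Lemma toric_coord_indep : gy != 0 /\ v gy = 0.
Proof.
have Gu0 : G \mPo u != 0.
  by apply: contra_neq G0 => e; rewrite -[G](comp_uz uz) e comp_mpoly0.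
have e0' : U i0 ^+ e0 != 0 by rewrite expf_neq0.
have gy0 : gy != 0.
  apply/eqP => g00; move: gyE; rewrite g00 mul0r => /esym/eqP.
  by rewrite rfun_eq0 (negbTE Gu0).
split=> //; have := congr1 v gyE; rewrite (vM gy0 e0') (valX vM _ (U0 i0)) vU.
rewrite (toric_val_rfun zu _ _ Gu0) (curve_order_homog uz G0 G_homog).
by rewrite -mulr_natr natz PoszM -[RHS]add0r => /addIr.
Qed.

End AlgebraicIndependence.

(** A vector killed by the rows other than [i0] is proportional to [b], and the row [i0] pairs with
    [b] to 1. *)
Lemma det_toric_exponent : \det (\matrix_(i, q) toric_exponent i q) != 0.
Proof.
rewrite -det_tr; apply/det0P => -[x nx0 /rowP xM].
have x_lift i : x 0 i * (b i0)%:Z = (b i)%:Z * x 0 i0.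
  have [->|ni] := eqVneq i i0; first by rewrite mulrC.
  have := xM i; rewrite !mxE (bigD1 i0) //= (bigD1 i) //= big1 => [|q /andP[q0 qi]]; last first.
    by rewrite !mxE /toric_exponent (negbTE ni) (negbTE q0) (negbTE qi) subr0 mulr0.
  rewrite !mxE /toric_exponent (eq_sym i0 i) (negbTE ni) !eqxx.
  rewrite !mulr0n !mulr1n addr0 sub0r subr0 mulrN => /eqP; rewrite addrC subr_eq0 => /eqP ->.
  by rewrite mulrC.
have x0 : x 0 i0 = 0.
  have := xM i0; rewrite !mxE => /(congr1 ( *%R^~ (b i0)%:Z)); rewrite mul0r mulr_suml.
  rewrite (eq_bigr (fun q => x 0 i0 * (c q * (b q)%:Z))) => [|q _].
    by rewrite -mulr_sumr bezout mulr1.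
  by rewrite !mxE /toric_exponent eqxx mulrAC x_lift; ring.
case/eqP: nx0; apply/rowP => i; rewrite mxE; have /eqP := x_lift i.
by rewrite x0 mulr0 mulf_eq0 => /orP[/eqP //|]; rewrite eqz_nat gtn_eqF.
Qed.

Let du : 'M[{mpoly C[n]}]_n := \matrix_(q, j) (tnth u q)^`M(j).

(** By the chain rule the Jacobian determinant of [u] divides 1; orders of polynomials are natural
    numbers, so two that add up to 0 vanish. *)
Let det_du : \det du != 0 /\ curve_order z b (\det du) = 0%N.
Proof.
pose dz : 'M[{mpoly C[n]}]_n := \matrix_(l, i) ((tnth z l)^`M(i) \mPo u).
have e : dz *m du = 1%:M.
  apply/matrixP => l j; rewrite !mxE.
  transitivity ((tnth z l \mPo u)^`M(j)).
    by rewrite mderiv_comp_mpoly; apply: eq_bigr => i _; rewrite !mxE.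
  rewrite zu mderivX mnm1E; case: eqP => [->|_]; last by rewrite scale0r.
  rewrite scale1r; have -> : (U_(j) - U_(j) = 0 :> 'X_{1..n})%MM.
    by apply/mnmP => i; rewrite mnmBE subnn mnm0E.
  by rewrite mpolyX0.
have ed : \det dz * \det du = 1 by rewrite -det_mulmx e det1.
have : \det dz * \det du != 0 by rewrite ed oner_neq0.
rewrite mulf_eq0 negb_or => /andP[dz0 du0]; split=> //.
have := congr1 (curve_order z b) ed; rewrite (curve_orderM zu _ dz0 du0).
rewrite -[RHS]/(curve_order z b 1) -mpolyC1 curve_orderC ?oner_neq0 // => /eqP.
by rewrite addn_eq0 => /andP[_ /eqP].
Qed.

(** Logarithmic differentiation factors the Jacobian matrix as [diag(y)], the exponent matrix,
    [diag(1/u)] and the Jacobian matrix of [u]; their determinants have values 1, 0, [- \sum_i b i]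
    and 0. *)
Lemma toric_val_jacobian :
  v (\det (\matrix_(i < n, j < n) rderiv j (y i))) = 1 - \sum_i (b i)%:Z.
Proof.
pose MF : 'M[F]_n := \matrix_(i, q) (toric_exponent i q)%:~R.
have -> : \matrix_(i < n, j < n) rderiv j (y i) =
  diag_mx (\row_i y i) *m MF *m diag_mx (\row_i (U i)^-1) *m map_mx (@FracField.tofrac _) du.
  apply/matrixP => i j; rewrite mxE -[LHS](divfK (toric_coord_neq0 i)) -/(dlog j (y i)) mulrC.
  rewrite /toric_coord (dlog_prod j (fun q => UX0 q _)) -/(toric_coord i) !mxE mulr_sumr.
  apply: eq_bigr => q _; rewrite mul_mx_diag mul_diag_mx !mxE (dlogXz j _ (U0 q)).
  rewrite /dlog /U rderiv_rfun -[_ *~ _]mulrzr; rewrite -!mulrA; congr (_ * _).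
  by rewrite mulrCA [RHS]mulrCA; congr (_ * _); exact: mulrC.
rewrite !det_mulmx !det_diag det_map_mx.
have eM : \det MF = rfun (\det (\matrix_(i, q) toric_exponent i q))%:~R%:MP.
  have -> : MF = map_mx intr (\matrix_(i, q) toric_exponent i q).
    by apply/matrixP => i q; rewrite !mxE.
  by rewrite det_map_mx /rfun !rmorph_int.
have dM0 : (\det (\matrix_(i, q) toric_exponent i q))%:~R != 0 :> C.
  by rewrite intr_eq0 det_toric_exponent.
have n1 : \prod_i (\row_i y i) 0 i != 0.
  by apply/prodf_neq0 => i _; rewrite mxE toric_coord_neq0.
have n2 : \det MF != 0 by rewrite eM rfun_eq0 mpolyC_eq0.
have n3 : \prod_i (\row_i (U i)^-1) 0 i != 0.
  by apply/prodf_neq0 => i _; rewrite mxE invr_eq0; exact: U0.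
have [du0 vdu] := det_du.
have n4 : FracField.tofrac (\det du) != 0 by rewrite tofrac_eq0.
rewrite (vM (mulf_neq0 (mulf_neq0 n1 n2) n3) n4) (vM (mulf_neq0 n1 n2) n3) (vM n1 n2).
have -> : v (FracField.tofrac (\det du)) = 0.
  by rewrite -/(rfun _) (toric_val_rfun zu) // vdu.
have -> : v (\det MF) = 0 by rewrite eM (toric_val_C zu).
have -> : v (\prod_i (\row_i y i) 0 i) = 1.
  rewrite (eq_bigr y) => [|i _]; last by rewrite mxE.
  rewrite (val_prod vM toric_coord_neq0) (bigD1 i0) //= toric_val_coord eqxx big1 ?addr0 // => i ni.
  by rewrite toric_val_coord (negbTE ni).
have -> : v (\prod_i (\row_i (U i)^-1) 0 i) = - \sum_i (b i)%:Z.
  have Ui i : (U i)^-1 != 0 by rewrite invr_eq0; exact: U0.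
  rewrite (eq_bigr (fun i => (U i)^-1)) => [|i _]; last by rewrite mxE.
  rewrite (val_prod vM Ui) -sumrN; apply: eq_bigr => i _.
  by rewrite (valV vM (U0 i)) vU.
by rewrite !addr0.
Qed.

End ToricDivisor.

(** * Bounds on log canonical thresholds *)

Lemma int_bezout n (b : 'I_n -> nat) :
  exists (c : 'I_n -> int) (g : nat), \sum_i c i * (b i)%:Z = g%:Z /\ forall i, (g %| b i)%N.
Proof.
elim: n b => [|n IH] b.
  by exists (fun=> 0), 0%N; split=> [|[]]; rewrite ?big_ord0.
have [c [g [cg gb]]] := IH (fun i => b (lift ord0 i)).
have [s [t e]] := Bezoutz (b ord0)%:Z g%:Z.
exists (fun i => if unlift ord0 i is Some j then t * c j else s), (gcdn (b ord0) g).
split=> [|i].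
  rewrite big_ord_recl unlift_none -[RHS]e; congr (_ + _); rewrite -cg mulr_sumr.
  by apply: eq_bigr => j _; rewrite liftK mulrA.
case: (unliftP ord0 i) => [j ->|->]; last exact: dvdn_gcdl.
by apply: dvdn_trans (gb j); apply: dvdn_gcdr.
Qed.

Lemma dhomog_lsub (A : comNzRingType) n (g : 'M[A]_n) (f : {mpoly A[n]}) d :
  f \is d.-homog -> lsub g f \is d.-homog.
Proof.
have H m : lsub g 'X_[m] \is (mdeg m).-homog.
  rewrite /lsub comp_mpolyX mdegE; elim/big_rec2: _ => [|i e p _ IH]; first exact: dhomog1.
  apply: dhomogM IH; rewrite -[X in X.-homog]mul1n.
  apply: dhomogMn; rewrite tnth_mktuple; apply: rpred_sum => j _.
  by apply: rpredZ; rewrite dhomogX; apply/eqP/mdeg1.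
move=> fd; rewrite [f]mpolyE /lsub raddf_sum /= big_seq; apply: rpred_sum => m mf.
by rewrite comp_mpolyZ rpredZ // -(dhomog_mf fd mf) H.
Qed.

Lemma lsubM (A : comNzRingType) n (g h : 'M[A]_n) (f : {mpoly A[n]}) :
  lsub g (lsub h f) = lsub (h *m g) f.
Proof.
apply: (mpoly_rmorph_ext
  (f := comp_mpoly [tuple \sum_(j < n) g i j *: 'X_j | i < n] \o
        comp_mpoly [tuple \sum_(j < n) h i j *: 'X_j | i < n])
  (g := comp_mpoly [tuple \sum_(j < n) (h *m g) i j *: 'X_j | i < n])) => [c|i].
  by rewrite /= !comp_mpolyC.
rewrite /= -![_ \mPo _]/(lsub _ _) !lsubX /lsub raddf_sum -/(lsub _) /=.
under eq_bigr do rewrite comp_mpolyZ -[_ \mPo _]/(lsub _ _) lsubX scaler_sumr.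
rewrite exchange_big; apply: eq_bigr => j _; rewrite mxE scaler_suml.
by apply: eq_bigr => k _; rewrite scalerA.
Qed.

Lemma lsub1 (A : comNzRingType) n (f : {mpoly A[n]}) : lsub 1%:M f = f.
Proof.
apply: (mpoly_rmorph_ext
  (f := comp_mpoly [tuple \sum_(j < n) (1%:M : 'M[A]_n) i j *: 'X_j | i < n])
  (g := idfun)) => [c|i]; first by rewrite /= comp_mpolyC.
rewrite /= -[_ \mPo _]/(lsub _ _) lsubX (bigD1 i) //= big1 => [|j nj].
  by rewrite mxE eqxx scale1r addr0.
by rewrite mxE eq_sym (negbTE nj) scale0r.
Qed.

(** * Divisors attached to weighted linear coordinates *)

Section LinearDivisor.
Variables (C : numFieldType) (n : nat).
Local Notation F := {fraction {mpoly C[n]}}.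

(** Composition with this tuple is [dehomogenize i]. *)
Definition chart (i : 'I_n.+1) : n.+1.-tuple {mpoly C[n]} :=
  [tuple if unlift i j is Some j' then 'X_j' else 1 | j < n.+1].

Section Coordinates.
Variables (h : 'M[C]_n.+1) (i j0 : 'I_n.+1).
Hypotheses (hu : h \in unitmx) (hij0 : h i j0 != 0).

(* Inverse to each other: the coordinates [h^-1 x] on the chart [x_i = 1] with the
   [j0]-th one omitted, and the coordinates [x] in terms of these. *)
Definition chart_form (j : 'I_n.+1) : {mpoly C[n]} :=
  \sum_k invmx h j k *: tnth (chart i) k.

Definition chart_coord : n.-tuple {mpoly C[n]} :=
  [tuple chart_form (lift j0 q) | q < n].

(** With [y = h^-1 x], the equation [x_i = 1] of the chart reads [\sum_j h i j * y_j = 1]; it is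
    solved for the omitted [y_j0], which requires [h i j0 != 0]. *)
Definition chart_section (j : 'I_n.+1) : {mpoly C[n]} :=
  if unlift j0 j is Some q then 'X_q
  else (h i j0)^-1 *: (1 - \sum_q h i (lift j0 q) *: 'X_q).

Definition chart_inverse : n.-tuple {mpoly C[n]} :=
  [tuple \sum_j h (lift i l) j *: chart_section j | l < n].

Lemma chart_form_lift q : chart_form (lift j0 q) = tnth chart_coord q.
Proof. by rewrite tnth_mktuple. Qed.

Let lcomb (A B : 'M[C]_n.+1) (X : 'I_n.+1 -> {mpoly C[n]}) j :
  A *m B = 1%:M -> \sum_k A j k *: (\sum_l B k l *: X l) = X j.
Proof.
move=> AB; transitivity (\sum_l (A *m B) j l *: X l).
  under eq_bigr do rewrite scaler_sumr.
  rewrite exchange_big; apply: eq_bigr => l _; rewrite mxE scaler_suml.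
  by apply: eq_bigr => k _; rewrite scalerA.
rewrite AB (bigD1 j) //= big1 => [|l nl]; first by rewrite mxE eqxx scale1r addr0.
by rewrite mxE eq_sym (negbTE nl) scale0r.
Qed.

Let chart_i : tnth (chart i) i = 1.
Proof. by rewrite tnth_mktuple unlift_none. Qed.

Let chart_lift l : tnth (chart i) (lift i l) = 'X_l.
Proof. by rewrite tnth_mktuple liftK. Qed.

Lemma sum_chart_form k : \sum_j h k j *: chart_form j = tnth (chart i) k.
Proof. by apply: lcomb; rewrite mulmxV. Qed.

Let sum_section_i : \sum_j h i j *: chart_section j = 1.
Proof.
rewrite (bigD1_ord j0) //= /chart_section unlift_none scalerA mulfV // scale1r.
rewrite -[RHS](subrK (\sum_q h i (lift j0 q) *: 'X_q)); congr (_ + _).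
by apply: eq_bigr => q _; rewrite liftK.
Qed.

Let chart_comp_inverse k :
  tnth (chart i) k \mPo chart_inverse = \sum_j h k j *: chart_section j.
Proof.
case: (unliftP i k) => [l ->|->].
  by rewrite chart_lift comp_mpolyXU -tnth_nth tnth_mktuple.
by rewrite chart_i comp_mpoly1 sum_section_i.
Qed.

Lemma chart_coordK q : tnth chart_coord q \mPo chart_inverse = 'X_q.
Proof.
rewrite tnth_mktuple /chart_form raddf_sum /=.
rewrite (eq_bigr (fun k => invmx h (lift j0 q) k *: \sum_j h k j *: chart_section j)).
  by rewrite lcomb ?mulVmx // /chart_section liftK.
by move=> k _; rewrite comp_mpolyZ chart_comp_inverse.
Qed.

Let section_comp_coord j : chart_section j \mPo chart_coord = chart_form j.
Proof.
rewrite /chart_section; case: (unliftP j0 j) => [q ->|->].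
  by rewrite comp_mpolyXU -tnth_nth chart_form_lift.
have e : (\sum_q h i (lift j0 q) *: 'X_q) \mPo chart_coord =
    \sum_q h i (lift j0 q) *: chart_form (lift j0 q).
  rewrite raddf_sum; apply: eq_bigr => q _ /=.
  by rewrite comp_mpolyZ comp_mpolyXU -tnth_nth chart_form_lift.
rewrite comp_mpolyZ comp_mpolyB comp_mpoly1 e; have := sum_chart_form i.
rewrite chart_i (bigD1_ord j0) //= => <-.
by rewrite addrK scalerA mulVf // scale1r.
Qed.

Lemma chart_inverseK l : tnth chart_inverse l \mPo chart_coord = 'X_l.
Proof.
rewrite tnth_mktuple raddf_sum -chart_lift -sum_chart_form /=.
by apply: eq_bigr => j _; rewrite comp_mpolyZ section_comp_coord.
Qed.

Lemma chart_lsub (f : {mpoly C[n.+1]}) :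
  f \mPo chart i = lsub h f \mPo [tuple chart_form j | j < n.+1].
Proof.
apply: (mpoly_rmorph_ext (f := comp_mpoly (chart i))
  (g := comp_mpoly [tuple chart_form j | j < n.+1] \o
        comp_mpoly [tuple \sum_(j < n.+1) h i j *: 'X_j | i < n.+1])) => [c|k] /=.
  by rewrite !comp_mpolyC.
have e : tnth [tuple \sum_(j < n.+1) h i j *: 'X_j | i < n.+1] k =
    \sum_(j < n.+1) h k j *: 'X_j :> {mpoly C[n.+1]} by rewrite tnth_mktuple.
rewrite !comp_mpolyXU -!tnth_nth e -sum_chart_form.
rewrite [RHS]raddf_sum; apply: eq_bigr => j _ /=.
by rewrite comp_mpolyZ comp_mpolyXU -tnth_nth tnth_mktuple.
Qed.

End Coordinates.

(** Omitting a coordinate [j0] of least weight leaves weights [b q = a (lift j0 q) - a j0 >= 0],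
    which define a monomial valuation. With [mu = - a j0] they add up to [(n+1) mu], and a monomial
    of degree [d] and weight at least [kappa] has shifted weight at least [kappa + d mu]. The factor
    [g] is the gcd of the [b q], by which the valuation is normalized. *)
Lemma linear_divisor (f : {mpoly C[n.+1]}) (d : nat) (h : 'M[C]_n.+1)
    (a : 'I_n.+1 -> int) (kappa : int) :
  f \is d.-homog -> h \in unitmx -> \sum_i a i = 0 -> (exists j, a j != 0) ->
  0 <= kappa ->
  (forall m, m \in msupp (lsub h f) -> kappa <= \sum_i a i * (m i)%:Z) ->
  exists (i : 'I_n.+1) (v : F -> int) (y : 'I_n -> F) (mu : int) (g : nat),
  [/\ 0 < mu, (0 < g)%N,
      [/\ forall c : C, c != 0 -> v (rfun c%:MP) = 0,
          forall x x', x != 0 -> x' != 0 -> v (x * x') = v x + v x',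
          forall x x', x != 0 -> x' != 0 -> x + x' != 0 ->
            Num.min (v x) (v x') <= v (x + x')
        & forall p, p != 0 -> 0 <= v (rfun p)],
      exists i0 : 'I_n,
        [/\ y i0 != 0, v (y i0) = 1
          & forall p : {mpoly C[n.-1]}, p != 0 ->
              let py := mmap (fun c : C => rfun c%:MP) (fun j => y (lift i0 j)) p in
              py != 0 /\ v py = 0]
    & g%:Z * (1 - v (\det (\matrix_(i < n, j < n) rderiv j (y i)))) = n.+1%:Z * mu /\
      kappa + d%:Z * mu <= g%:Z * v (rfun (f \mPo chart i))].
Proof.
move=> fd hu a0 [j1 aj1] k0 mk.
pose j0 := [arg min_(j < j1) a j]%O.
have aj0 j : a j0 <= a j by rewrite /j0; case: arg_minP => // k _ kP; apply: kP.
have [i hij0] : exists i, h i j0 != 0.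
  apply: contrapT => no; have : \det h = 0.
    rewrite (expand_det_col _ j0) big1 // => i _.
    by have [->|hn] := eqVneq (h i j0) 0; [rewrite mul0r | case: no; exists i].
  by move/eqP; apply/negP; rewrite -unitfE -unitmxE.
pose b q : nat := `|a (lift j0 q) - a j0|%N.
have bE q : (b q)%:Z = a (lift j0 q) - a j0 by rewrite /b abszE ger0_norm // subr_ge0.
pose mu := - a j0.
have sumb : \sum_q (b q)%:Z = n.+1%:Z * mu.
  rewrite (eq_bigr (fun q => a (lift j0 q) - a j0)) => [|q _]; last exact: bE.
  rewrite sumrB sumr_const card_ord; have := a0; rewrite (bigD1_ord j0) //= => e.
  have -> : \sum_q a (lift j0 q) = - a j0.
    by apply/eqP; rewrite -addr_eq0 addrC e.
  by rewrite -[a j0 *+ n]mulr_natr natz /mu intS; ring.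
have [q0 bq0] : exists q, (0 < b q)%N.
  apply: contrapT => no.
  have b00 q : b q = 0%N by case: (posnP (b q)) => // bq; case: no; exists q.
  have mu0 : a j0 = 0.
    by move: sumb; rewrite big1 => [|q _]; [rewrite /mu; lia | rewrite b00].
  case/eqP: aj1; case: (unliftP j0 j1) => [q ->|->] //.
  by have := bE q; rewrite b00 mu0; lia.
have mu_gt0 : 0 < mu.
  have : 0 < n.+1%:Z * mu; last by rewrite pmulr_rgt0.
  rewrite -sumb (bigD1 q0) //=; apply: ltr_wpDr; last by rewrite ltz_nat.
  by apply: sumr_ge0.
have [c [g [cg gb]]] := int_bezout b.
have g_gt0 : (0 < g)%N by rewrite lt0n; apply/eqP => g0; have := gb q0; rewrite g0 dvd0n => /eqP e; rewrite e in bq0.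
pose b' q := (b q %/ g)%N.
have b'E q : (b q)%:Z = (b' q)%:Z * g%:Z by rewrite -PoszM divnK.
have b'0 : (0 < b' q0)%N by rewrite divn_gt0 // dvdn_leq.
have bez : \sum_q c q * (b' q)%:Z = 1.
  have g0 : g%:Z != 0 by rewrite eqz_nat -lt0n.
  apply: (mulIf g0); rewrite mul1r -[RHS]cg mulr_suml; apply: eq_bigr => q _.
  by rewrite b'E mulrA.
pose u := chart_coord h i j0; pose z := chart_inverse h i j0.
have uz : forall q, tnth u q \mPo z = 'X_q := chart_coordK hu hij0.
have zu : forall l, tnth z l \mPo u = 'X_l := chart_inverseK hu hij0.
(* [K] also serves as the value at 0, so that the bound persists if [f] vanishes on the chart. *)
pose K := kappa + d%:Z * mu.
have K0 : 0 <= K by rewrite addr_ge0 // mulr_ge0 // ltW.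
pose v := toric_val z b' K.
have vM x x' : x != 0 -> x' != 0 -> v (x * x') = v x + v x' := toric_valM zu b' K (x := x) (y := x').
have vD x x' : x != 0 -> x' != 0 -> x + x' != 0 -> Num.min (v x) (v x') <= v (x + x') :=
  toric_valD zu b' K (x := x) (y := x').
exists i, v, (toric_coord u b' c q0), mu, g; split=> //.
- split=> [x x0||x|p p0]; [exact: toric_val_C | exact: vM | exact: vD | exact: toric_val_ge0].
- exists q0; split; first exact: toric_coord_neq0.
    by rewrite /v (toric_val_coord uz zu) ?eqxx.
  by move=> p p0; apply: toric_coord_indep.
split.
  rewrite /v (toric_val_jacobian uz zu K bez b'0) opprB addrCA subrr addr0 mulr_sumr -sumb.
  by apply: eq_bigr => q _; rewrite b'E mulrC.
have [->|f0] := eqVneq (rfun (f \mPo chart i)) 0.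
  rewrite /v toric_val0 -/K -{1}[K]mul1r; apply: ler_wpM2r => //.
rewrite leNgt; apply/negP => lt.
pose V := v (rfun (f \mPo chart i)).
(* If [g V < K], every term of the expansion of [f] has value greater than [V], hence at least
   [V + 1], and so has their sum. *)
suff : V + 1 <= V by lia.
rewrite {2}/V (chart_lsub i hu) /= comp_mpolyE /rfun rmorph_sum /=.
have := f0; rewrite (chart_lsub i hu) comp_mpolyE /rfun rmorph_sum /= => s0.
apply: (val_sum_ge vD) s0 => m mf t0.
(* The power of the omitted form [y_j0] is a polynomial on the chart and contributes a value at
   least 0. *)
pose w := (lsub h f)@_m *: chart_form h i j0 ^+ m j0.
have tE : (lsub h f)@_m *: \prod_(j < n.+1) tnth [tuple chart_form h i j | j < n.+1] j ^+ m j =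
    w * \prod_q tnth u q ^+ m (lift j0 q).
  rewrite (bigD1_ord j0) //= tnth_mktuple -scalerAl; congr (_ *: (_ * _)).
  by apply: eq_bigr => q _; rewrite tnth_mktuple chart_form_lift.
pose P := \prod_q tnth u q ^+ m (lift j0 q).
have PE : P = 'X_[[multinom m (lift j0 q) | q < n]] \mPo u.
  by rewrite comp_mpolyX; apply: eq_bigr => q _; rewrite mnmE.
move: t0; rewrite tE -/P -/(rfun _) rfun_eq0 mulf_eq0 negb_or => /andP[w0 P0].
rewrite (rfunM w P) vM ?rfun_eq0 //.
have vw : 0 <= v (rfun w) := toric_val_ge0 zu b' K w0.
have -> : v (rfun P) = \sum_q (b' q)%:Z * (m (lift j0 q))%:Z.
  rewrite /v (toric_val_rfun zu b' K P0) PE.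
  rewrite (curve_order_homog uz (e := (\sum_q b' q * m (lift j0 q))%N)); last first.
  - by move=> k; rewrite msuppX inE => /eqP ->; apply: eq_bigr => q _; rewrite mnmE.
  - by rewrite -msupp_eq0 msuppX.
  rewrite -[LHS]natz natr_sum; apply: eq_bigr => q _.
  by rewrite natrM !natz.
have md : \sum_j (m j)%:Z = d%:Z.
  have := dhomog_mf (dhomog_lsub h fd) mf; rewrite /= mdegE => <-.
  by rewrite -[RHS]natz natr_sum; apply: eq_bigr => q _; rewrite natz.
have gS : g%:Z * (\sum_q (b' q)%:Z * (m (lift j0 q))%:Z) = \sum_j a j * (m j)%:Z + d%:Z * mu.
  transitivity (\sum_j (a j - a j0) * (m j)%:Z).
    rewrite (bigD1_ord j0) //= subrr mul0r add0r mulr_sumr; apply: eq_bigr => q _.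
    by rewrite -bE b'E mulrA [g%:Z * _]mulrC.
  rewrite -md mulr_suml -big_split; apply: eq_bigr => j _ /=.
  by rewrite /mu mulrBl mulrN mulrC [_ * a j0]mulrC.
have := mk m mf; have := lt; rewrite -/V -/K => lt' mk'.
have : g%:Z * V < g%:Z * (v (rfun w) + \sum_q (b' q)%:Z * (m (lift j0 q))%:Z).
  have gw : 0 <= g%:Z * v (rfun w) by rewrite mulr_ge0.
  by apply: lt_le_trans lt' _; rewrite mulrDr gS -[K]add0r lerD // lerD2r.
by rewrite ltr_pM2l ?ltz_nat // lezD1.
Qed.

End LinearDivisor.

Section LctBound.
Variables (R : realType) (n d : nat).
Hypothesis d_gt0 : (0 < d)%N.
Variables (f : {mpoly R[i][n.+1]}) (h : 'M[R[i]]_n.+1) (a : 'I_n.+1 -> int).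
Hypotheses (fd : f \is d.-homog) (hu : h \in unitmx) (a0 : \sum_i a i = 0).

(** If [(P^n, t F)] is log canonical with [t >= 0], the discrepancy inequality multiplied by [g]
    gives [t (kappa + d mu) <= t g V <= g (1 - J) = (n+1) mu], for [J] and [V] the values of the
    Jacobian and of [f]. *)
Lemma lct_weight_bound (kappa : int) : (exists j, a j != 0) -> 0 <= kappa ->
  (forall m, m \in msupp (lsub h f) -> kappa <= \sum_i a i * (m i)%:Z) ->
  exists2 mu : int, 0 < mu & lct f <= n.+1%:R * mu%:~R / (kappa + d%:Z * mu)%:~R.
Proof.
move=> aj k0 mk.
have [i [v [y [mu [g [mu0 g0 [vC vM vD vp] yP [e1 e2]]]]]]] :=
  linear_divisor fd hu a0 aj k0 mk.
exists mu => //.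
have div : divisor_over v y by split=> //; split.
have {}e1 : g%:Z * (1 - v (jacobian y)) = n.+1%:Z * mu := e1.
have {}e2 : kappa + d%:Z * mu <= g%:Z * v (ratfun (dehomogenize i f)) := e2.
have K0 : 0 < kappa + d%:Z * mu by rewrite ltr_wpDl // mulr_gt0 // ltz_nat.
have bound t : log_canonical t f -> t * (kappa + d%:Z * mu)%:~R <= n.+1%:R * mu%:~R.
  move=> /(_ i v y div); rewrite /discrepancy.
  move: (v (jacobian y)) (v (ratfun (dehomogenize i f))) e1 e2 => J V e1 e2 le.
  have g0' : 0 < g%:R :> rat by rewrite ltr0n.
  (* The value of [f] is only bounded below, so a negative [t] is treated by signs. *)
  have [t0|/ltW t0] := leP 0 t; last first.
    apply: (le_trans (y := 0)); last by rewrite mulr_ge0 // ler0z ltW.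
    by rewrite mulr_le0_ge0 // ler0z ltW.
  have e1' : g%:R * (1 - J%:~R) = n.+1%:R * mu%:~R :> rat.
    by have := congr1 (fun x : int => x%:~R : rat) e1; rewrite !rmorphM /= rmorphB.
  have e2' : (kappa + d%:Z * mu)%:~R <= g%:R * V%:~R :> rat.
    by move: e2; rewrite -(ler_int rat) [X in _ <= X -> _]rmorphM.
  apply: le_trans (ler_wpM2l t0 e2') _; rewrite -e1' mulrCA ler_pM2l //.
  by move: le; move: (t * _) => tV; lra.
have K0' : 0 < (kappa + d%:Z * mu)%:~R :> R by rewrite ltr0z.
have ge0 : 0 <= n.+1%:R * mu%:~R / (kappa + d%:Z * mu)%:~R :> R.
  by rewrite divr_ge0 ?mulr_ge0 ?ler0z // ltW.
rewrite /lct; set S := (X in sup X).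
have [S0|nS] := pselect (S !=set0)%classic; last first.
  by rewrite sup_out // => -[].
apply: ge_sup => // _ [t [lc ->]]; rewrite ler_pdivlMr //.
have := bound t lc; rewrite -(ler_rat R) !rmorphM /= !ratr_int ratr_nat.
by [].
Qed.

Lemma lct_le_of_weight : (exists j, a j != 0) ->
  (forall m, m \in msupp (lsub h f) -> 0 <= \sum_i a i * (m i)%:Z) ->
  lct f <= n.+1%:R / d%:R.
Proof.
move=> aj /(lct_weight_bound aj (lexx 0))[mu mu0].
rewrite add0r rmorphM /= -mulf_div divff ?mulr1 //.
by rewrite intr_eq0 gt_eqF.
Qed.

(** Positive integral weights are at least 1, so [kappa = 1] is allowed and
    [(n+1) mu / (1 + d mu) < (n+1) / d]. The weights are not all 0, since [lsub h f] has a
    monomial. *)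
Lemma lct_lt_of_weight : f != 0 ->
  (forall m, m \in msupp (lsub h f) -> 0 < \sum_i a i * (m i)%:Z) ->
  lct f < n.+1%:R / d%:R.
Proof.
move=> f0 mk.
have F0 : lsub h f != 0.
  apply: contra_neq f0 => e; rewrite -[f]lsub1 -(mulmxV hu) -lsubM e.
  by rewrite /lsub comp_mpoly0.
have aj : exists j, a j != 0.
  apply: contrapT => no; have := mk _ (mlead_supp F0).
  by rewrite big1 ?ltxx // => j _; have [->|aj] := eqVneq (a j) 0; rewrite ?mul0r //; case: no; exists j.
have [|mu mu0 le] := @lct_weight_bound 1 aj ler01; first by move=> m /mk.
apply: le_lt_trans le _.
have mu0' : 0 < mu%:~R :> R by rewrite ltr0z.
have d0 : 0 < d%:R :> R by rewrite ltr0n.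
rewrite rmorphD rmorphM /= ltr_pdivrMr; last by rewrite addr_gt0 ?mulr_gt0.
rewrite -mulrA ltr_pM2l ?ltr0n // mulrC ltr_pdivlMr // mulrC ltrDr.
by rewrite ltr01.
Qed.

End LctBound.

(** * Pluecker vectors as tensors *)

Section PlueckerTensor.
Variables (C : numFieldType) (N d k : nat).
Local Notation TI := {ffun 'I_k * 'I_d -> 'I_N}.
Implicit Types (f : {mpoly C[N]}) (X : 'I_k -> {mpoly C[N]}) (s : {ffun 'I_d -> 'I_N}).

Definition fmon s : 'X_{1..N} := (\sum_l U_(s l))%MM.

Lemma mdeg_fmon s : mdeg (fmon s) = d.
Proof.
rewrite /fmon mdeg_sum (eq_bigr (fun=> 1%N)) => [|l _]; last exact: mdeg1.
by rewrite sum_nat_const card_ord muln1.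
Qed.

Lemma prod_fmon s : \prod_l 'X_(s l) = 'X_[fmon s] :> {mpoly C[N]}.
Proof. by rewrite -mprodXE. Qed.

Lemma fmon_weight (a : 'I_N -> int) s : \sum_i a i * (fmon s i)%:Z = \sum_l a (s l).
Proof.
under eq_bigr => i _.
  rewrite /fmon mnm_sumE -[X in _ * X]natz natr_sum mulr_sumr; over.
rewrite exchange_big; apply: eq_bigr => l _ /=.
rewrite (bigD1 (s l)) //= mnm1E eqxx mulr1 big1 ?addr0 // => i ni.
by rewrite mnm1E eq_sym (negbTE ni) mulr0.
Qed.

Lemma fmon_surj (m : 'X_{1..N}) : mdeg m = d -> exists s, fmon s = m.
Proof.
move=> md; have sz : size (m2s m) == d by rewrite size_m2s md.
exists [ffun l => tnth (Tuple sz) l]; apply/mnmP => i; rewrite /fmon mnm_sumE.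
rewrite -[in RHS](s2mK m) mnmE -[m2s m]/(tval (Tuple sz)) -sum1_count [RHS]big_mkcond [RHS]big_tuple.
by apply: eq_bigr => l _; rewrite ffunE mnm1E /=; case: (_ == _).
Qed.

(** For [f] of degree [d], this is [d!] times the coordinate at [s] of the symmetric tensor of
    [f]. *)
Definition tens f s : C := apolar f (\prod_l 'X_(s l)).

Lemma tensE f s : tens f s = f@_(fmon s) * (mfact (fmon s))%:R.
Proof.
rewrite /tens prod_fmon; elim/mpolyind: f => [|c m f _ _ IH].
  by rewrite apolar0l mcoeff0 mul0r.
rewrite apolarDl apolarZl mcoeffD mcoeffZ IH mulrDl -mulrA; congr (_ * _ + _).
rewrite /apolar msuppX big_seq1 !mcoeffX eqxx mul1r eq_sym mulrC.
by case: eqP => [->|]; rewrite ?mul0r.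
Qed.

Lemma mfact_neq0 (m : 'X_{1..N}) : (mfact m)%:R != 0 :> C.
Proof. by rewrite pnatr_eq0 -lt0n prodn_gt0 // => i; apply: fact_gt0. Qed.

(** The substitution passes by apolar adjunction to the product of the ['X_(t l)], which then
    expands over all [s]. *)
Lemma tens_lsub f (g : 'M[C]_N) t :
  tens (lsub g f) t = \sum_s tens f s * \prod_l g (s l) (t l).
Proof.
have e : lsub g^T (\prod_l 'X_(t l)) = \prod_l \sum_j g^T (t l) j *: 'X_j.
  by rewrite /lsub rmorph_prod; apply: eq_bigr => l _; exact: lsubX.
rewrite /tens -{1}(trmxK g) -apolar_lsub e.
rewrite bigA_distr_bigA apolar_sumr; apply: eq_bigr => s _.
rewrite mulrC -apolarZr; congr apolar.
rewrite -mul_mpolyC rmorph_prod -big_split; apply: eq_bigr => l _ /=.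
by rewrite mul_mpolyC mxE.
Qed.

Definition tcol (S : TI) (j : 'I_k) : {ffun 'I_d -> 'I_N} := [ffun l => S (j, l)].

(** The Pluecker vector as a tensor with [k * d] factors, the index [(j, l)] being the [l]-th factor
    of the [j]-th form. *)
Definition ptens X (S : TI) : C := \det (\matrix_(i < k, j < k) tens (X i) (tcol S j)).

(** The determinant is multilinear in its columns; a choice of [s] for each column is, after
    uncurrying, a single tensor index. *)
Lemma ptens_lsub X (g : 'M[C]_N) T :
  ptens (fun i => lsub g (X i)) T = tact (ptens X) g T.
Proof.
pose w (s : {ffun 'I_d -> 'I_N}) (j : 'I_k) := \prod_l g (s l) (T (j, l)).
transitivity (\sum_(F : {ffun 'I_k -> {ffun 'I_d -> 'I_N}})
    (\prod_j w (F j) j) * \det (\matrix_(i < k, j < k) tens (X i) (F j))).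
  rewrite /ptens -det_tr [LHS]/determinant.
  under eq_bigr => p _.
    under eq_bigr => j _.
      rewrite !mxE tens_lsub (eq_bigr (fun s => tens (X (p j)) s * w s j)) => [|s _]; last first.
        by congr (_ * _); apply: eq_bigr => l _; rewrite ffunE.
      over.
    rewrite (bigA_distr_bigA (fun j s => tens (X (p j)) s * w s j)) mulr_sumr; over.
  rewrite exchange_big; apply: eq_bigr => F _.
  rewrite -[in RHS]det_tr /determinant mulr_sumr; apply: eq_bigr => p _.
  rewrite big_split /= [RHS]mulrC -mulrA; congr (_ * (_ * _)).
  by apply: eq_bigr => j _; rewrite !mxE.
rewrite /tact.
pose curry (S : TI) : {ffun 'I_k -> {ffun 'I_d -> 'I_N}} := [ffun j => tcol S j].
pose uncurry (F : {ffun 'I_k -> {ffun 'I_d -> 'I_N}}) : TI := [ffun jl => F jl.1 jl.2].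
have cK : cancel curry uncurry by move=> S; apply/ffunP => -[j l]; rewrite !ffunE.
have uK : cancel uncurry curry.
  by move=> F; apply/ffunP => j; apply/ffunP => l; rewrite !ffunE.
rewrite (reindex curry) /=; last by exists uncurry => x _; [apply: cK | apply: uK].
apply: eq_bigr => S _; rewrite mulrC; congr (_ * _).
  by congr (\det _); apply/matrixP => i j; rewrite !mxE ffunE.
rewrite [RHS](eq_bigr (fun jl => g (S (jl.1, jl.2)) (T (jl.1, jl.2)))) => [|[]] //.
rewrite -(pair_bigA _ (fun j l => g (S (j, l)) (T (j, l)))) /=; apply: eq_bigr => j _.
by apply: eq_bigr => l _; rewrite !ffunE.
Qed.

Lemma ptensE X S : ptens X S = \prod_j (mfact (fmon (tcol S j)))%:R *
  \det (\matrix_(i < k, j < k) (X i)@_(fmon (tcol S j))).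
Proof.
pose D : 'rV[C]_k := \row_j (mfact (fmon (tcol S j)))%:R.
rewrite /ptens (_ : \matrix_(i, j) _ = (\matrix_(i < k, j < k) (X i)@_(fmon (tcol S j))) *m diag_mx D).
  rewrite det_mulmx det_diag mulrC; congr (_ * _).
  by apply: eq_bigr => j _; rewrite mxE.
by apply/matrixP => i j; rewrite mul_mx_diag !mxE tensE.
Qed.

Lemma ptens_weight (a : 'I_N -> int) (S : TI) :
  \sum_jl a (S jl) = \sum_j \sum_i a i * (fmon (tcol S j) i)%:Z.
Proof.
rewrite (eq_bigr (fun jl => a (S (jl.1, jl.2)))) => [|[]] //.
rewrite -(pair_bigA _ (fun j l => a (S (j, l)))) /=; apply: eq_bigr => j _.
by rewrite fmon_weight; apply: eq_bigr => l _; rewrite ffunE.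
Qed.

(** No nonzero combination of the [X i] loses all its bad monomials, so the matrix of bad
    coefficients has rank [k] and some [k] of its columns form a nonzero minor. *)
Lemma ptens_minor X (bad : pred 'X_{1..N}) :
  (forall i, X i \is d.-homog) ->
  (forall z : 'rV[C]_k, z != 0 ->
     exists2 m, m \in msupp (\sum_i z 0 i *: X i) & bad m) ->
  exists2 S, ptens X S != 0 & forall j, bad (fmon (tcol S j)).
Proof.
move=> Xd h; pose I := #|{ffun 'I_d -> 'I_N}|.
pose Q : 'M[C]_(k, I) := \matrix_(i, q)
  if bad (fmon (enum_val q)) then tens (X i) (enum_val q) else 0.
have fQ : row_full Q^T.
  rewrite /row_full mxrank_tr -/(row_free Q).
  rewrite -kermx_eq0 -submx0; apply/row_subP => r.
  have : row r (kermx Q) *m Q = 0 by rewrite -row_mul mulmx_ker row0.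
  set z := row r _ => zQ; have [->|z0] := eqVneq z 0; first exact: sub0mx.
  have [m mz bm] := h z z0.
  have md : mdeg m = d.
    have /dhomog_mf -> // : \sum_i z 0 i *: X i \is d.-homog.
    by apply: rpred_sum => i _; apply: rpredZ.
  have [s sm] := fmon_surj md; move: mz; rewrite mcoeff_msupp.
  have /matrixP/(_ 0 (enum_rank s)) := zQ; rewrite !mxE.
  rewrite (eq_bigr (fun i => z 0 i * (X i)@_m * (mfact m)%:R)) => [|i _]; last first.
    by rewrite !mxE enum_rankK sm bm tensE sm mulrA.
  rewrite -mulr_suml => /eqP; rewrite mulf_eq0 (negbTE (mfact_neq0 _)) orbF => /eqP e.
  by rewrite raddf_sum /= (eq_bigr (fun i => z 0 i * (X i)@_m)) ?e ?eqxx // => i _; rewrite mcoeffZ.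
have := fullrowsub_unit fQ; rewrite unitmxE unitfE.
set phi := fullrankfun fQ => dphi.
pose S : TI := [ffun jl => (enum_val (phi jl.1) : {ffun 'I_d -> 'I_N}) jl.2].
have colS j : tcol S j = enum_val (phi j) by apply/ffunP => l; rewrite !ffunE.
(* The other columns of [Q] are 0 and cannot enter an invertible minor. *)
have bS j : bad (fmon (tcol S j)).
  apply: contraNT dphi => nb; apply/eqP; rewrite (expand_det_row _ j) big1 // => i _.
  by rewrite !mxE -colS (negbTE nb) mul0r.
exists S => //; move: dphi; rewrite -det_tr; apply: contra_neq => e.
rewrite -{}e; congr (\det _); apply/matrixP => i j.
by rewrite !mxE -colS bS.
Qed.

End PlueckerTensor.

(** * Homogeneous components of an invariant *)

Lemma poly_eq_of_horner (C : numFieldType) (p q : {poly C}) :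
  (forall t, t != 0 -> p.[t] = q.[t]) -> p = q.
Proof.
move=> pq; apply/eqP; rewrite -subr_eq0; apply/negP => /negP nz.
pose rs : seq C := [seq i.+1%:R | i <- iota 0 (size (p - q))].
have := @max_poly_roots _ (p - q) rs nz; rewrite size_map size_iota ltnn => h.
suff : false by []; apply: h.
  apply/allP => _ /mapP[i _ ->]; rewrite rootE hornerD hornerN pq ?subrr //.
  by rewrite pnatr_eq0.
rewrite map_inj_uniq ?iota_uniq // => i j /eqP; rewrite eqr_nat => /eqP.
by case.
Qed.

Section Homogeneous.
Variables (C : numFieldType) (n : nat).
Implicit Types (P : {mpoly C[n]}) (v : 'I_n -> C).

Lemma meval_dhomog P e c v : P \is e.-homog -> P.@[fun i => c * v i] = c ^+ e * P.@[v].
Proof.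
move=> Pe; rewrite !mevalE mulr_sumr; apply: eq_big_seq => m mP.
have <- : mdeg m = e by apply: (dhomog_mf Pe).
rewrite mulrCA; congr (_ * _); rewrite mdegE -prodrXr -big_split.
by apply: eq_bigr => i _; rewrite exprMn.
Qed.

Lemma mpoly_pihomogE P : P = \sum_(e < msize P) pihomog mdeg e P.
Proof. by rewrite -pihomog_partitionE. Qed.

Lemma meval_pihomog P c v :
  P.@[fun i => c * v i] = (\poly_(e < msize P) (pihomog mdeg e P).@[v]).[c].
Proof.
rewrite {1}[P]mpoly_pihomogE raddf_sum horner_poly; apply: eq_bigr => e _ /=.
by rewrite (meval_dhomog _ _ (pihomogP _ _ _)) mulrC.
Qed.

(** Both sides are polynomials in [c] whose coefficients are the values of the homogeneous
    components. *)
Lemma meval_pihomog_eq P v v' :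
  (forall c, P.@[fun i => c * v i] = P.@[fun i => c * v' i]) ->
  forall e, (pihomog mdeg e P).@[v] = (pihomog mdeg e P).@[v'].
Proof.
move=> h e; have [lt|le] := ltnP e (msize P); last first.
  have -> : pihomog mdeg e P = 0.
    rewrite pihomogE big_seq_cond big1 // => m /andP[mP /eqP me].
    by have := msize_mdeg_lt mP; rewrite me ltnNge le.
  by rewrite !meval0.
have : \poly_(e < msize P) (pihomog mdeg e P).@[v] =
       \poly_(e < msize P) (pihomog mdeg e P).@[v'].
  by apply: poly_eq_of_horner => t _; rewrite -!meval_pihomog.
by move=> /polyP/(_ e); rewrite !coef_poly lt.
Qed.

(** Otherwise [c |-> P (c v)] is constant, and its values at 0 and 1 agree. *)
Lemma pihomog_nonvanishing P v : P.@[v] = 0 -> P.@[fun=> 0] != 0 ->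
  exists2 e, (0 < e)%N & (pihomog mdeg e P).@[v] != 0.
Proof.
move=> Pv P0; apply: contrapT => no.
have z e : (0 < e)%N -> (pihomog mdeg e P).@[v] = 0.
  by move=> e0; apply: contrapT => /eqP ne; apply: no; exists e.
pose p := \poly_(e < msize P) (pihomog mdeg e P).@[v].
have p1 : p.[1] = 0.
  by rewrite -Pv -meval_pihomog; apply: meval_eq => i; rewrite mul1r.
have pC : p = (p`_0)%:P.
  apply/polyP => -[|e]; rewrite coefC //= coef_poly; case: ifP => // _; exact: z.
have p0 : p.[0] = P.@[fun=> 0].
  by rewrite -meval_pihomog; apply: meval_eq => i; rewrite mul0r.
by case/eqP: P0; rewrite -p0 pC hornerC; rewrite pC hornerC in p1.
Qed.

End Homogeneous.

(** * Semistability *)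

Section PlueckerCoordinates.
Variables (R : realType) (n d k : nat).
Local Notation C := R[i].
Local Notation TI := {ffun 'I_k * 'I_d -> 'I_n.+1}.

Lemma fmon_bound (s : {ffun 'I_d -> 'I_n.+1}) : (mdeg (fmon s) < d.+1)%N.
Proof. by rewrite mdeg_fmon. Qed.

Definition tmonomial (s : {ffun 'I_d -> 'I_n.+1}) : monomial n d :=
  exist (fun m : 'X_{1..n.+1 < d.+1} => mdeg m == d)
    (BMultinom (fmon_bound s)) (introT eqP (mdeg_fmon s)).

Definition tpluecker (S : TI) : pluecker_index n d k := [ffun j => tmonomial (tcol S j)].

Definition tfact (S : TI) : C := \prod_j (mfact (fmon (tcol S j)))%:R.

Lemma tfact_neq0 S : tfact S != 0.
Proof. by apply/prodf_neq0 => j _; apply: mfact_neq0. Qed.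

Lemma ptens_pluecker (X : 'I_k -> {mpoly C[n.+1]}) S :
  ptens X S = tfact S * pluecker X (tpluecker S).
Proof.
rewrite ptensE /pluecker /tfact; apply: congr1; apply: congr1.
by apply/matrixP => i j; rewrite !mxE ffunE.
Qed.

Lemma tpluecker_surj (s : pluecker_index n d k) : exists S, tpluecker S = s.
Proof.
have h j : exists t : {ffun 'I_d -> 'I_n.+1}, fmon t = val (val (s j)).
  exact: (fmon_surj (elimT eqP (proj2_sig (s j)))).
have [t tE] := choice h.
exists [ffun jl => t jl.1 jl.2]; apply/ffunP => j; apply/val_inj/val_inj.
rewrite ffunE /= -tE; congr fmon; by apply/ffunP => l; rewrite !ffunE.
Qed.

End PlueckerCoordinates.

Section LinearSystem.
Variables (R : realType) (n d : nat).
Local Notation C := R[i].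
Variable T : {vspace dhomog n.+1 C d}.
Local Notation k := (\dim T).
Let X (i : 'I_k) : {mpoly C[n.+1]} := tnth (vbasis T) i.

Lemma system_minor (h : 'M[C]_n.+1) (bad : pred 'X_{1..n.+1}) :
  (forall f : dhomog n.+1 C d, f \in T -> f != 0 ->
     exists2 m, m \in msupp (lsub h f) & bad m) ->
  exists2 S : {ffun 'I_k * 'I_d -> 'I_n.+1},
    tact (ptens X) h S != 0 & forall j, bad (fmon (tcol S j)).
Proof.
move=> H; have [|z z0|S nz bS] := @ptens_minor _ _ d k (fun i => lsub h (X i)) bad.
- by move=> i; apply: dhomog_lsub; apply: dhomog_is_dhomog.
- pose f : dhomog n.+1 C d := \sum_i z 0 i *: tnth (vbasis T) i.
  have fT : f \in T by apply: memv_suml => i _; apply: memvZ; apply: vbasis_mem; apply: mem_tnth.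
  have f0 : f != 0.
    apply: contra_neq z0 => f0; apply/rowP => i; rewrite mxE.
    have /freeP fr := basis_free (vbasisP T).
    apply: (fr (fun i => z 0 i)); rewrite -[RHS]f0 /f; apply: eq_bigr => l _.
    by rewrite -tnth_nth.
  have fE : lsub h f = \sum_i z 0 i *: lsub h (X i).
    rewrite /f raddf_sum /lsub raddf_sum; apply: eq_bigr => i _.
    rewrite -comp_mpolyZ /=; apply: congr1; exact: linearZ.
  by have [m mf bm] := H f fT f0; exists m => //; rewrite -fE.
by exists S => //; rewrite -ptens_lsub.
Qed.

Hypothesis d_gt0 : (0 < d)%N.

Lemma semistable_of_lct :
  (forall f : dhomog n.+1 C d, f \in T -> f != 0 -> n.+1%:R / d%:R <= lct f) ->
  semistable T.
Proof.
move=> H.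
have [h a hu a0|F [Finv Fp F0]] := @hilbert_mumford C n.+1 ('I_k * 'I_d)%type (ptens X) (ltn0Sn n).
(* A member without monomials of weight at most 0 would have a threshold below [(n+1)/d]; a minor on
   such monomials is a tensor coordinate of weight at most 0. *)
- have [f fT f0|S nz bS] := @system_minor h [pred m : 'X_{1..n.+1} | \sum_i a i * (m i)%:Z <= 0].
    apply: contrapT => no; have := H f fT f0; rewrite leNgt => /negP; apply.
    apply: (lct_lt_of_weight d_gt0 (dhomog_is_dhomog f) hu a0) => // m mf.
    by rewrite ltNge; apply/negP => le; apply: no; exists m.
  by exists S => //; rewrite ptens_weight; apply: sumr_le0 => j _; apply: bS.
(* [F] is rewritten in Pluecker coordinates, of which the tensor coordinates are nonzero
   multiples. *)
pose P0 : {mpoly C[#|pluecker_index n d k|]} := F \mPo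
  [tuple tfact R (enum_val q) *: 'X_(enum_rank (tpluecker (enum_val q))) | q < #|{ffun 'I_k * 'I_d -> 'I_n.+1}|].
have P0E c (Y : 'I_k -> {mpoly C[n.+1]}) :
    P0.@[fun s => c * pluecker Y (enum_val s)] = F.@[fun q => c * ptens Y (enum_val q)].
  rewrite /P0 comp_mpoly_meval; apply: meval_eq => q.
  by rewrite tnth_mktuple mevalZ mevalXU enum_rankK ptens_pluecker mulrCA.
have P0v : P0.@[fun s => pluecker X (enum_val s)] = 0.
  rewrite -Fp; transitivity P0.@[fun s => 1 * pluecker X (enum_val s)].
    by apply: meval_eq => s; rewrite mul1r.
  by rewrite P0E; apply: meval_eq => s; rewrite mul1r.
have P00 : P0.@[fun=> 0] != 0.
  apply: contra_neq F0 => e; rewrite -e; transitivity F.@[fun q => 0 * ptens X (enum_val q)].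
    by apply: meval_eq => q; rewrite mul0r.
  by rewrite -P0E; apply: meval_eq => s; rewrite mul0r.
have [e e0 Pe] := pihomog_nonvanishing P0v P00.
exists e, (pihomog mdeg e P0); split; [exact: e0 | | exact: Pe].
split; first exact: pihomogP.
(* Invariance of [P0] at all multiples [c] of the Pluecker vector descends to its homogeneous
   components. *)
move=> Y A _ detA; apply: meval_pihomog_eq => c; rewrite !P0E.
pose Y' i : {mpoly C[n.+1]} := tnth Y i.
transitivity F.@[fun q => tact (fun S => c * ptens Y' S) A (enum_val q)].
  apply: meval_eq => q; transitivity (c * ptens (fun i => lsub A (Y' i)) (enum_val q)); first by [].
  rewrite ptens_lsub /tact mulr_sumr.
  by apply: eq_bigr => S _; rewrite mulrA.
by rewrite Finv.
Qed.

End LinearSystem.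

(** * Stability *)

Section OneParameterSubgroup.
Variables (C : numFieldType) (n : nat) (l : C -> 'M[C]_n) (e : nat) (M : 'M[{poly C}]_n).
Hypothesis lE : forall t, t != 0 -> l t = t ^- e *: map_mx (horner_eval t) M.
Hypothesis det_l : forall t, t != 0 -> \det (l t) = 1.
Hypothesis lM : forall s t, s != 0 -> t != 0 -> l (s * t) = l s *m l t.

Let L t := map_mx (horner_eval t) M.
Let D := (\max_i \max_j size (M i j))%N.
Let Mc (i : nat) : 'M[C]_n := \matrix_(a, b) (M a b)`_i.

Let LE t : L t = \sum_(i < D) t ^+ i *: Mc i.
Proof.
apply/matrixP => a b; rewrite !mxE summxE /horner_eval (@horner_coef_wide _ D).
  by apply: eq_bigr => i _; rewrite !mxE mulrC.
apply: leq_trans (leq_bigmax a); exact: (leq_bigmax (F := fun b => size (M a b)) b).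
Qed.

Let LM s t : s != 0 -> t != 0 -> L (s * t) = L s *m L t.
Proof.
move=> s0 t0; have e0 (x : C) : x != 0 -> x ^+ e != 0 by move=> ?; apply: expf_neq0.
have lL x : x != 0 -> L x = x ^+ e *: l x by move=> x0; rewrite lE // scalerA mulfV ?e0 // scale1r.
rewrite !lL ?mulf_neq0 // lM // exprMn -scalemxAl -scalemxAr scalerA.
by [].
Qed.

(** Comparison of the coefficients of [s^i] in [L (s * t) = L s *m L t]; the nonzero rows of [Mc i]
    are left eigenvectors of every [L t]. *)
Let Mc_L (i : 'I_D) t : t != 0 -> Mc i *m L t = t ^+ i *: Mc i.
Proof.
move=> t0; apply/matrixP => a b.
have : \poly_(j < D) ((Mc j *m L t) a b) = \poly_(j < D) ((t ^+ j *: Mc j) a b).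
  apply: poly_eq_of_horner => s s0; rewrite !horner_poly.
  transitivity ((L s *m L t) a b).
    rewrite [L s]LE mulmx_suml summxE; apply: eq_bigr => j _.
    by rewrite -scalemxAl [RHS]mxE mulrC.
  rewrite -LM // LE summxE; apply: eq_bigr => j _.
  by rewrite !mxE exprMn; ring.
by move=> /polyP/(_ i); rewrite !coef_poly ltn_ord.
Qed.

Let sum_Mc : \sum_(i < D) Mc i = 1%:M.
Proof.
have l1 : l 1 = 1%:M.
  have u1 : l 1 \in unitmx by rewrite unitmxE det_l ?oner_neq0 // unitr1.
  have := lM (oner_neq0 C) (oner_neq0 C); rewrite mulr1 => e1.
  by rewrite -(mulKmx u1 (l 1)) -e1 mulVmx.
rewrite -l1 lE ?oner_neq0 // expr1n invr1 scale1r -/(L 1) LE.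
by apply: eq_bigr => i _; rewrite expr1n scale1r.
Qed.

(** The rows of the [Mc i] span, because the [Mc i] add up to the identity; a basis chosen among
    them gives [h], and the weights are the indices [i] shifted by [- e]. *)
Lemma one_parameter_diag : exists2 h : 'M[C]_n, h \in unitmx &
  exists a : 'I_n -> int, \sum_i a i = 0 /\
    forall t, t != 0 -> l t = invmx h *m diag_mx (\row_j t ^ a j) *m h.
Proof.
pose I := #|{: 'I_D * 'I_n}|.
pose ev (q : 'I_I) : 'I_D * 'I_n := enum_val q.
pose B : 'M[C]_(I, n) := \matrix_(q, b) Mc (ev q).1 (ev q).2 b.
have fB : row_full B.
  apply/row_fullP; exists (\matrix_(a, q) ((ev q).2 == a)%:R).
  rewrite -sum_Mc; apply/matrixP => a b; rewrite mxE summxE.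
  rewrite (reindex (fun x : 'I_D * 'I_n => enum_rank x)) /=; last first.
    by exists enum_val => x _; [exact: enum_rankK | exact: enum_valK].
  under eq_bigr => x _ do rewrite !mxE /ev enum_rankK.
  rewrite -(pair_bigA _ (fun (i : 'I_D) (j : 'I_n) => (j == a)%:R * (M j b)`_i)) /=; apply: eq_bigr => i _.
  rewrite (bigD1 a) //= eqxx mul1r big1 ?addr0 ?mxE // => j nj.
  by rewrite (negbTE nj) mul0r.
have hu := fullrowsub_unit fB; set phi := fullrankfun fB in hu.
pose h := rowsub phi B; pose ex j : nat := (ev (phi j)).1.
exists h => //; exists (fun j => (ex j)%:Z - e%:Z).
have hL t : t != 0 -> h *m L t = diag_mx (\row_j t ^+ ex j) *m h.
  move=> t0; apply/matrixP => j b; rewrite mul_diag_mx 2!mxE [h j b in RHS]mxE mxE.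
  have := Mc_L (ev (phi j)).1 t0 => /matrixP/(_ (ev (phi j)).2 b).
  rewrite !mxE => <-; apply: eq_bigr => c _; by rewrite !mxE.
have lh t : t != 0 -> l t = invmx h *m diag_mx (\row_j t ^ ((ex j)%:Z - e%:Z)) *m h.
  move=> t0; rewrite lE // -mulmxA -[map_mx _ M](mulKmx hu) scalemxAr; congr (_ *m _).
  rewrite -/(L t) hL // scalemxAl; congr (_ *m _); apply/matrixP => i j.
  rewrite !mxE expfzDr // -exprnN mulrC.
  by case: eqP => [->|]; rewrite ?mulr1n // !mulr0n mul0r.
(* At [t = 2] the determinant condition reads [2 ^ s = 1] for the sum [s] of the weights, which
   forces [s = 0]. *)
split=> //; have t0 : 2 != 0 :> C by rewrite pnatr_eq0.
have := det_l t0; rewrite lh // !det_mulmx det_inv det_diag mulrAC mulVr ?mul1r; last first.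
  by rewrite -unitmxE; exact: hu.
set s := \sum_i _; have -> : \prod_i (\row_j 2 ^ ((ex j)%:Z - e%:Z)) 0 i = 2 ^ s :> C.
  rewrite /s; elim/big_rec2: _ => [|i x y _ ->]; first by rewrite expr0z.
  by rewrite mxE [RHS](expfzDr _ _ t0).
case: s => [[|m]|m] //.
  by move/eqP; rewrite gt_eqF // exprn_egt1 // ltr1n.
rewrite NegzE -exprnN => /(congr1 GRing.inv); rewrite invrK invr1.
by move/eqP; rewrite gt_eqF // exprn_egt1 // ltr1n.
Qed.

End OneParameterSubgroup.

Section Stability.
Variables (R : realType) (n d : nat).
Local Notation C := R[i].
Variable T : {vspace dhomog n.+1 C d}.
Local Notation k := (\dim T).
Local Notation TI := {ffun 'I_k * 'I_d -> 'I_n.+1}.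
Let X (i : 'I_k) : {mpoly C[n.+1]} := tnth (vbasis T) i.
Hypotheses (d_gt0 : (0 < d)%N) (k_gt0 : (0 < k)%N).

Section Weight.
Variables (h : 'M[C]_n.+1) (a : 'I_n.+1 -> int) (l : C -> 'M[C]_n.+1).
Hypothesis hu : h \in unitmx.
Hypothesis lE : forall t, t != 0 -> l t = invmx h *m diag_mx (\row_j t ^ a j) *m h.

Let p (Q : TI) : C := tact (ptens X) (invmx h) Q.
Let wt (Q : TI) : int := \sum_jl a (Q jl).

Lemma weight_of_minimum (S1 : TI) : p S1 != 0 ->
  (forall Q, p Q != 0 -> wt S1 <= wt Q) -> hilbert_mumford_weight T l (- wt S1).
Proof.
move=> pS1 S1min.
pose ex Q : nat := `|wt Q - wt S1|%N.
pose q (S : TI) : {poly C} := \sum_Q (p Q * \prod_jl h (Q jl) (S jl)) *: 'X^(ex Q).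
have qE t S : t != 0 -> (q S).[t] = t ^ (- wt S1) * ptens (fun i => act (l t) (X i)) S.
  move=> t0; transitivity (t ^ (- wt S1) * tact (tact p (diag_mx (\row_j t ^ a j))) h S).
    rewrite /q horner_sum /tact mulr_sumr; apply: eq_bigr => Q _.
    rewrite hornerZ hornerXn -[\sum_s _]/(tact p (diag_mx (\row_j t ^ a j)) Q) tact_diag.
    have -> : \prod_jl (\row_j t ^ a j) 0 (Q jl) = t ^ wt Q.
      rewrite /wt; elim/big_rec2: _ => [|i x y _ ->]; first by rewrite expr0z.
      by rewrite mxE expfzDr.
    have [->|pQ] := eqVneq (p Q) 0; first by rewrite !mul0r mulr0.
    have -> : t ^+ ex Q = t ^ (- wt S1) * t ^ wt Q.
      by rewrite -expfzDr // exprnP /ex abszE ger0_norm ?subr_ge0 ?S1min // addrC.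
    by rewrite mulrCA [X in _ * X]mulrAC.
  apply: congr1; rewrite -[RHS]/(ptens (fun i => lsub (l t) (X i)) S) ptens_lsub lE //.
  rewrite tactM /p tactM mulmxA; by [].
have [Sg SgK] := choice (@tpluecker_surj n d k).
pose qq s := (tfact R (Sg s))^-1 *: q (Sg s).
have qqE t s : t != 0 ->
    t ^ (- wt S1) * pluecker (fun i => act (l t) (X i)) s = (qq s).[t].
  move=> t0; rewrite /qq hornerZ qE // ptens_pluecker SgK mulrCA; congr (_ * _).
  by rewrite mulKf // tfact_neq0.
exists qq; split; first by move=> t s; exact: qqE.
apply: contrapT => no.
have q0 S : (q S).[0] = 0.
  have -> : q S = tfact R S *: qq (tpluecker S).
    apply: poly_eq_of_horner => t t0.
    by rewrite hornerZ -qqE // qE // ptens_pluecker mulrCA.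
  rewrite hornerZ; apply/eqP; rewrite mulf_eq0; apply/orP; right.
  by apply: contrapT => /negP nz; apply: no; exists (tpluecker S).
(* The part of least weight. If all the limits were 0 then [tact p0 h = 0], hence [p0 = 0] as [h] is
   invertible, against [p S1 != 0]. *)
pose p0 Q := p Q * (ex Q == 0%N)%:R.
have : p0 S1 = 0.
  rewrite -[LHS]tact1 -(mulmxV hu) -tactM /tact big1 // => S _.
  rewrite [X in X * _](_ : _ = 0) ?mul0r // -[RHS](q0 S) /q horner_sum.
  apply: eq_bigr => Q _; rewrite hornerZ hornerXn /p0 mulrAC; congr (_ * _).
  by case: (ex Q) => [|m]; rewrite ?expr0 // expr0n.
move/eqP; rewrite /p0 /ex subrr eqxx mulr1.
by rewrite (negbTE pS1).
Qed.

End Weight.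

Lemma stable_of_lct :
  (forall f : dhomog n.+1 C d, f \in T -> f != 0 -> n.+1%:R / d%:R < lct f) ->
  stable T.
Proof.
move=> H l [[e [M lM]] detl mull] [t1 t10 lt1].
have [h hu [a [a0 lE]]] := one_parameter_diag lM detl mull.
have hu' : invmx h \in unitmx by rewrite unitmx_inv.
have aj : exists j, a j != 0.
  apply: contrapT => no; case/eqP: lt1; rewrite lE // (_ : diag_mx _ = 1%:M) ?mulmx1 ?mulVmx //.
  apply/matrixP => i j; rewrite !mxE.
  have [->|ai] := eqVneq (a i) 0; first by rewrite expr0z.
  by case: no; exists i.
(* A member whose monomials in the eigencoordinates all have weight at least 0 would have a
   threshold of at most [(n+1)/d]. *)
have [f fT f0|S0 pS0 bS0] := @system_minor R n d T (invmx h) [pred m : 'X_{1..n.+1} | \sum_i a i * (m i)%:Z < 0].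
  apply: contrapT => no; have := H f fT f0; rewrite ltNge => /negP; apply.
  apply: (lct_le_of_weight d_gt0 (dhomog_is_dhomog f) hu' a0 aj) => m mf.
  by rewrite leNgt; apply/negP => lt; apply: no; exists m.
pose p (Q : TI) : C := tact (ptens X) (invmx h) Q.
pose wt (Q : TI) : int := \sum_jl a (Q jl).
pose S1 := [arg min_(Q < S0 | p Q != 0) wt Q]%O.
have [pS1 S1min] : p S1 != 0 /\ forall Q, p Q != 0 -> wt S1 <= wt Q.
  by rewrite /S1; case: arg_minP.
exists (- wt S1); first exact: (weight_of_minimum hu lE pS1 S1min).
rewrite oppr_gt0; apply: le_lt_trans (S1min _ pS0) _.
(* The weight of [S0] is a sum of [k] negative integers, and [k > 0] makes it negative. *)
rewrite /wt ptens_weight (bigD1 (Ordinal k_gt0)) //=.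
rewrite -[X in _ < X]addr0; apply: ltr_leD; first exact: bS0.
by apply: sumr_le0 => j _; apply: ltW; exact: bS0.
Qed.

End Stability.

Theorem theorem1p2 (R : realType) (n d k : nat)
    (hn : (1 <= n)%N) (hd : (1 <= d)%N) (hk : (1 <= k)%N)
    (T : {vspace dhomog n.+1 R[i] d}) (hT : \dim T = k) :
  ((forall f : dhomog n.+1 R[i] d, f \in T -> f != 0 ->
      n.+1%:R / d%:R <= lct f) -> semistable T)
  /\
  ((forall f : dhomog n.+1 R[i] d, f \in T -> f != 0 ->
      n.+1%:R / d%:R < lct f) -> stable T).
Proof.
split; first exact: semistable_of_lct.
by apply: stable_of_lct; rewrite // hT.
Qed.
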